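(* Let $N\ge2$ be an integer, let $s\in\mathbb C$, and let $\mathbf r=(r_1,\dots,r_N)\in\mathbb C^N$ satisfy $\sum_{i=1}^N r_i-\frac{N-1}{2}=s$ and $r_1-r_2=\alpha\in\mathbb Z_{\ge0}$. Let $W_{1+\infty}$ act on $\mathbb C[[t_1,t_2,\dots]]$ via the representation with central charge $N$ attached to $(s,N)$ (described in the context), and let $\mathbf e_i$ denote the $i$-th standard basis vector of $\mathbb C^N$. For $\mathbf q\in\{\mathbf r,\ \mathbf r+\mathbf e_1-\mathbf e_2\}$ let $\tau_{\mathbf q}$ be the tau-function of the Bessel plane $W_{\mathbf q}$ and let $\mathcal M_{\mathbf q}$ be the $W_{1+\infty}$-submodule generated by $\tau_{\mathbf q}$. Then $\tau_{\mathbf r+\mathbf e_1-\mathbf e_2}$ is a singular vector in the module $\mathcal M_{\mathbf r}$, and it is given by $$\tau_{\mathbf r+\mathbf e_1-\mathbf e_2}=W(A)\,\tau_{\mathbf r}+C\,\tau_{\mathbf r}$$ for some constant $C\in\mathbb C$, where $$A=-(\alpha+1)\,\frac{z^{-1}P_{\mathbf r}(D_z)}{D_z-r_2}\,\bigl(z^{-1}P_{\mathbf r}(D_z)\bigr)^{\alpha}\in\mathcal D,\qquad P_{\mathbf r}(D)=\prod_{i=1}^N(D-r_i),$$ and $\frac{z^{-1}P_{\mathbf r}(D_z)}{D_z-r_2}$ denotes $z^{-1}\prod_{i\ne2}(D_z-r_i)$. Therefore $\mathcal M_{\mathbf r+\mathbf e_1-\mathbf e_2}\hookrightarrow\mathcal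 M_{\mathbf r}$ (as a $W_{1+\infty}$-submodule).
   Context: **The algebra.** $\mathcal D=\mathbb C[z,z^{-1}][\partial_z]$ is the Lie algebra of regular differential operators on the circle, and $D=D_z=z\partial_z$. $W_{1+\infty}=\{W(A):A\in\mathcal D\}\oplus\mathbb Cc$, with $A\mapsto W(A)$ linear and injective, is its central extension with $c$ central and (as generating series in $x,y$) $$[W(z^ke^{xD}),W(z^me^{yD})]=(e^{xm}-e^{yk})W(z^{k+m}e^{(x+y)D})+\delta_{k,-m}\frac{e^{xm}-e^{yk}}{1-e^{x+y}}\,c .$$ For $k\in\mathbb Z$, $l\ge0$ put $L^l_k=W(-z^kD_z^l)$. **Fock space.** $V=\bigoplus_{j\in\mathbb Z}\mathbb Cv_j$. $F^{(0)}$ is the span of the semi-infinite monomials $v_{i_0}\wedge v_{i_1}\wedge\cdots$ with $i_0>i_1>\cdots$ and $i_k=-k$ for $k\gg0$; $\widetilde F^{(0)}$ is its formal completion (arbitrary formal linear combinations of these monomials); $|0\rangle=v_0\wedge v_{-1}\wedge v_{-2}\wedge\cdots$. The matrix unit $E_{ij}$ ($E_{ij}v_k=\delta_{jk}v_i$) acts on $F^{(0)}$ as a derivation of the wedge product; call this $r(E_{ij})$. Set $\hat r(E_{ij})=r(E_{ij})-\delta_{ij}$ if $j\le 0$, and $\hat r(E_{ij})=r(E_{ij})$ if $j>0$. Then $\hat r$ extends linearly to all $\mathbb Z\times\mathbb Z$ matrices with finitely many nonzero diagonals, acting on $F^{(0)}$ and on $\widetilde F^{(0)}$. **The representation attached to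 $(s,N)$.** Put $z=\zeta^N$, so $D_z=\frac1N\zeta\partial_\zeta$, and identify $v_k=e^{N\zeta}\zeta^{s-k}$, $k\in\mathbb Z$. Each $A\in\mathcal D$ then acts on $V$ by a matrix with finitely many nonzero diagonals (e.g. $zv_k=v_{k-N}$, $D_zv_k=v_{k-1}+\frac{s-k}{N}v_k$), again denoted $A$. The representation is $c\mapsto N$, $W(A)\mapsto\hat r(A)+\gamma(A)\,\mathrm{Id}$, where $\gamma:\mathcal D\to\mathbb C$ is the unique linear functional making this a Lie algebra representation of $W_{1+\infty}$. Explicitly $\gamma(z^ke^{xD_z})=0$ for $k>0$ and $$\gamma(e^{xD_z})=\frac{1}{1-e^{x/N}}-\frac{N}{1-e^x}+\frac{e^{sx/N}-1}{1-e^{x/N}};$$ for $k<0$, $\gamma(z^kf(D_z))$ is determined by $W(z^kf(D_z))=\frac1k[W(D_z),W(z^kf(D_z))]$. **Boson–fermion correspondence.** Let $J_n=-\hat r(\zeta^n)$, where $\zeta^n$ denotes the matrix $v_k\mapsto v_{k-n}$. Let $\sigma:F^{(0)}\to\mathbb C[t_1,t_2,\dots]$ be the unique linear isomorphism with $\sigma(|0\rangle)=1$ under which $J_n$ corresponds to $\partial/\partial t_n$ and $J_{-n}$ to multiplication by $nt_n$ ($n>0$). It extends to $\widetilde F^{(0)}\to\mathbb C[[t_1,t_2,\dots]]$, and $W_{1+\infty}$ acts on $\mathbb C[[t_1,t_2,\dots]]$ via $\sigma$. **Bessel plane and tau-function.** For $\mathbf q\in\mathbb C^N$ with $s(\mathbf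 q):=\sum_i q_i-\frac{N-1}2=s$, let $P_{\mathbf q}(D)=\prod_i(D-q_i)$. There is a unique formal series $\Psi_{\mathbf q}(\zeta)=\zeta^{s}e^{N\zeta}\bigl(1+\sum_{i\ge1}a_i(\mathbf q)\zeta^{-i}\bigr)=v_0+\sum_{i\ge1}a_i(\mathbf q)v_i$ with $P_{\mathbf q}(D_z)\Psi_{\mathbf q}=z\Psi_{\mathbf q}$. The Bessel plane $W_{\mathbf q}$ is the space spanned by $D_z^k\Psi_{\mathbf q}$, $k\ge0$; it has a basis of the form $w_{-k}=v_{-k}+\sum_{i>-k}w_{i,-k}v_i$, $k=0,1,2,\dots$. Its tau-function is $\tau_{\mathbf q}=\sigma(w_0\wedge w_{-1}\wedge w_{-2}\wedge\cdots)\in\mathbb C[[t_1,t_2,\dots]]$ (independent of the choice of such a basis). Note that $s(\mathbf r+\mathbf e_1-\mathbf e_2)=s(\mathbf r)$. **Module and singular vectors.** $\mathcal M_{\mathbf q}=U(W_{1+\infty})\tau_{\mathbf q}$ (no completion). A singular vector of $\mathcal M_{\mathbf r}$ is a nonzero vector of $\mathcal M_{\mathbf r}$, not proportional to $\tau_{\mathbf r}$, which is annihilated by all $L^l_k$ with $k>0$, $l\ge0$, and is an eigenvector of all $L^l_0$, $l\ge0$. *)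

(* Defs.v *)
From HB Require Import structures.
From mathcomp Require Import all_boot all_order all_algebra.
From mathcomp Require Import finmap.
From mathcomp Require Import all_classical reals.
From mathcomp.real_closed Require Import complex.
From mathcomp.multinomials Require Import monalg.
Set Implicit Arguments. Unset Strict Implicit. Unset Printing Implicit Defensive.
Import Order.TTheory GRing.Theory Num.Theory.
Local Open Scope classical_set_scope.
Local Open Scope ring_scope.

(* The algebra of differential operators on the circle.  Since
   \partial_z = z^-1 D with D = z \partial_z, every element of
   C[z,z^-1][\partial_z] is uniquely a finite sum of z^k f_k(D); it is encoded
   by the finitely supported family k |-> f_k.  The relation D z = z (D + 1)
   gives  z^k f(D) z^m g(D) = z^(k+m) f(D+m) g(D).                            *)
Section DiffOp.
Variable C : fieldType.

Definition diffop := {malg {poly C}[int]}.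

HB.instance Definition _ := GRing.Zmodule.on diffop.

Definition zD (k : int) (f : {poly C}) : diffop := << f *g k >>.

Definition shiftp (m : int) (f : {poly C}) : {poly C} :=
  f \Po ('X + (m%:~R)%:P).

Definition dmul (A B : diffop) : diffop :=
  \sum_(k <- msupp A) \sum_(m <- msupp B) zD (k + m) (shiftp m A@_k * B@_m).

Definition dscale (a : C) (A : diffop) : diffop :=
  \sum_(k <- msupp A) zD k (a *: A@_k).

Lemma shiftp0 m : shiftp m 0 = 0. Proof. exact: comp_poly0. Qed.

Lemma shiftpD m f g : shiftp m (f + g) = shiftp m f + shiftp m g.
Proof. exact: comp_polyD. Qed.

Lemma shiftpM m f g : shiftp m (f * g) = shiftp m f * shiftp m g.
Proof. exact: comp_polyM. Qed.

Lemma shiftp_shiftp m n f : shiftp m (shiftp n f) = shiftp (n + m) f.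
Proof.
rewrite /shiftp -comp_polyA comp_polyD comp_polyX comp_polyC.
by rewrite -addrA -polyCD -intrD (addrC m).
Qed.

Lemma zD0 k : zD k 0 = 0. Proof. exact: monalgU0. Qed.

Lemma zDD k f g : zD k (f + g) = zD k f + zD k g.
Proof. exact: monalgUD. Qed.

Lemma dmulw (d1 d2 : {fset int}) (A B : diffop) :
  (msupp A `<=` d1)%fset -> (msupp B `<=` d2)%fset ->
  dmul A B =
  \sum_(k <- d1) \sum_(m <- d2) zD (k + m) (shiftp m A@_k * B@_m).
Proof.
move=> h1 h2; rewrite /dmul (big_fset_incl _ h1) /=; last first.
  move=> k _ /mcoeff_outdom ->; rewrite big1 // => m _.
  by rewrite shiftp0 mul0r zD0.
apply: eq_bigr => k _; apply/big_fset_incl => // m _ /mcoeff_outdom ->.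
by rewrite mulr0 zD0.
Qed.

Lemma dmul_zD k m f g : dmul (zD k f) (zD m g) = zD (k + m) (shiftp m f * g).
Proof.
by rewrite (dmulw msuppU_le msuppU_le) !big_seq_fset1 /zD !mcoeffUU.
Qed.

Lemma dmulDl : left_distributive dmul +%R.
Proof.
move=> A B E; pose d := (msupp A `|` msupp B)%fset.
have hA : (msupp A `<=` d)%fset by exact: fsubsetUl.
have hB : (msupp B `<=` d)%fset by exact: fsubsetUr.
rewrite (dmulw hA (fsubset_refl _)) (dmulw hB (fsubset_refl _)).
rewrite (dmulw (msuppD_le A B) (fsubset_refl _)) -big_split /=.
apply: eq_bigr => k _; rewrite -big_split /=; apply: eq_bigr => m _.
by rewrite mcoeffD shiftpD mulrDl zDD.
Qed.

Lemma dmulDr : right_distributive dmul +%R.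
Proof.
move=> E A B; pose d := (msupp A `|` msupp B)%fset.
have hA : (msupp A `<=` d)%fset by exact: fsubsetUl.
have hB : (msupp B `<=` d)%fset by exact: fsubsetUr.
rewrite (dmulw (fsubset_refl _) hA) (dmulw (fsubset_refl _) hB).
rewrite (dmulw (fsubset_refl _) (msuppD_le A B)) -big_split /=.
apply: eq_bigr => k _; rewrite -big_split /=; apply: eq_bigr => m _.
by rewrite mcoeffD mulrDr zDD.
Qed.

Lemma dmul0l : left_zero 0 dmul.
Proof. by move=> A; rewrite /dmul msupp0 big_seq_fset0. Qed.

Lemma dmul0r : right_zero 0 dmul.
Proof.
by move=> A; rewrite /dmul big1 // => k _; rewrite msupp0 big_seq_fset0.
Qed.

Lemma diffop_ind (P : diffop -> Prop) :
  P 0 -> (forall A B, P A -> P B -> P (A + B)) -> (forall k f, P (zD k f)) ->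
  forall A, P A.
Proof. by move=> P0 PD PU A; rewrite (monalgE A); elim/big_ind: _. Qed.

Lemma dmulA : associative dmul.
Proof.
move=> A B E; elim/diffop_ind: A => [|A A' hA hA'|k f].
- by rewrite !dmul0l.
- by rewrite !dmulDl hA hA'.
elim/diffop_ind: B => [|B B' hB hB'|m g].
- by rewrite dmul0r !dmul0l dmul0r.
- by rewrite dmulDr !dmulDl dmulDr hB hB'.
elim/diffop_ind: E => [|E E' hE hE'|n h].
- by rewrite !dmul0r.
- by rewrite !dmulDr hE hE'.
by rewrite !dmul_zD shiftpM shiftp_shiftp mulrA addrA.
Qed.

Lemma dmul1l : left_id (zD 0 1) dmul.
Proof.
move=> A; elim/diffop_ind: A => [|A A' hA hA'|k f]; first exact: dmul0r.
  by rewrite dmulDr hA hA'.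
by rewrite dmul_zD add0r /shiftp comp_polyC mul1r.
Qed.

Lemma dmul1r : right_id (zD 0 1) dmul.
Proof.
move=> A; elim/diffop_ind: A => [|A A' hA hA'|k f]; first exact: dmul0l.
  by rewrite dmulDl hA hA'.
by rewrite dmul_zD addr0 /shiftp mulr0z addr0 comp_polyXr mulr1.
Qed.

HB.instance Definition _ := GRing.Zmodule_isPzRing.Build diffop
  dmulA dmul1l dmul1r dmulDl dmulDr.

Lemma dscaleE a A k : (dscale a A)@_k = a *: A@_k.
Proof.
rewrite /dscale raddf_sum /=; have [kA|kA] := boolP (k \in msupp A).
  rewrite (big_fsetD1 k) //= /zD mcoeffUU big1_fset ?addr0 // => m.
  by rewrite in_fsetD1 mcoeffU => /andP[/negbTE ->].
rewrite (mcoeff_outdom kA) scaler0 big1_fset // => m mA _.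
by rewrite /zD mcoeffU; case: eqP kA => // <-; rewrite mA.
Qed.

Lemma dscaleA a b A : dscale a (dscale b A) = dscale (a * b) A.
Proof. by apply/malgP => k; rewrite !dscaleE scalerA. Qed.

Lemma dscale1 : left_id 1 dscale.
Proof. by move=> A; apply/malgP => k; rewrite dscaleE scale1r. Qed.

Lemma dscaleDr : right_distributive dscale +%R.
Proof.
by move=> a A B; apply/malgP => k; rewrite mcoeffD !dscaleE mcoeffD scalerDr.
Qed.

Lemma dscaleDl A : {morph dscale^~ A : a b / a + b}.
Proof.
by move=> a b; apply/malgP => k; rewrite mcoeffD !dscaleE scalerDl.
Qed.

HB.instance Definition _ := GRing.Zmodule_isLmodule.Build C diffop
  dscaleA dscale1 dscaleDr dscaleDl.

(* The central term of [W(z^k f(D)), W(z^-k g(D))], namely the bilinear form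
   with generating series (e^(-kx) - e^(ky)) / (1 - e^(x+y)), i.e. the
   geometric sum  \sum_(0 <= j < k) e^((j-k)x + jy)  for k >= 0  and
   - \sum_(0 <= j < -k) e^(jx + (j+k)y)  for k < 0.                           *)
Definition cocycle_mono (k : int) (f g : {poly C}) : C :=
  match k with
  | Posz n => \sum_(j < n) f.[(j%:Z - n%:Z)%:~R] * g.[j%:R]
  | Negz n => - \sum_(j < n.+1) f.[j%:R] * g.[(j%:Z - n.+1%:Z)%:~R]
  end.

Definition cocycle (A B : diffop) : C :=
  \sum_(k <- msupp A) cocycle_mono k A@_k B@_(- k).

(* Elements of W_(1+oo) = W(diffop) + C c are the pairs (A, a) = W(A) + a c. *)
Definition W1oo := (diffop * C)%type.

Definition W (A : diffop) : W1oo := (A, 0).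

Definition Wbracket (X Y : W1oo) : W1oo :=
  (X.1 * Y.1 - Y.1 * X.1, cocycle X.1 Y.1).

Definition L (k : int) (l : nat) : W1oo := W (- zD k 'X^l).

(* The two lemmas below are the defining relation of the central term, read
   off on the coefficient of x^i y^j / (i! j!) after multiplication by
   1 - e^(x+y).                                                               *)
Lemma cocycle_zD k f m g :
  cocycle (zD k f) (zD m g) = if m == - k then cocycle_mono k f g else 0.
Proof.
have c0 k' p : cocycle_mono k' p 0 = 0.
  by case: k' => n /=; rewrite big1 ?oppr0 // => j _; rewrite horner0 mulr0.
have c0' k' p : cocycle_mono k' 0 p = 0.
  by case: k' => n /=; rewrite big1 ?oppr0 // => j _; rewrite horner0 mul0r.
have E : cocycle (zD k f) (zD m g) =
    cocycle_mono k (zD k f)@_k (zD m g)@_(- k).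
  rewrite /cocycle /zD msuppU; have [->|_] := eqVneq f 0.
    by rewrite big_seq_fset0 monalgU0 mcoeff0 c0'.
  by rewrite big_seq_fset1.
rewrite E /zD mcoeffUU mcoeffU; case: eqP => _; first by rewrite mulr1n.
by rewrite mulr0n c0.
Qed.

Lemma cocycle_gen k i j :
  let q a b := cocycle (zD k 'X^a) (zD (- k) 'X^b) in
  q i j - \sum_(a < i.+1) \sum_(b < j.+1) q a b *+ 'C(j, b) *+ 'C(i, a) =
  (- k)%:~R ^+ i * (0 : C) ^+ j - (0 : C) ^+ i * k%:~R ^+ j.
Proof.
move=> q.
have tel (n : nat) (X Y : nat -> C) :
    (forall c, X c.+1 = X c + 1) -> (forall c, Y c.+1 = Y c + 1) ->
    let p a b := \sum_(c < n) X c ^+ a * Y c ^+ b in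
    p i j - \sum_(a < i.+1) \sum_(b < j.+1) p a b *+ 'C(j, b) *+ 'C(i, a) =
    X 0%N ^+ i * Y 0%N ^+ j - X n ^+ i * Y n ^+ j.
  move=> XS YS p.
  have -> : \sum_(a < i.+1) \sum_(b < j.+1) p a b *+ 'C(j, b) *+ 'C(i, a) =
      \sum_(c < n) X c.+1 ^+ i * Y c.+1 ^+ j.
    under eq_bigr do under eq_bigr do rewrite /p -!sumrMnl.
    under eq_bigr do rewrite exchange_big.
    rewrite exchange_big /=; apply: eq_bigr => c _.
    rewrite XS YS (addrC (X c)) (addrC (Y c)) !exprDn mulr_suml.
    apply: eq_bigr => a _; rewrite mulr_sumr; apply: eq_bigr => b _.
    by rewrite !expr1n !mul1r mulrnAl mulrnAr.
  rewrite /p -sumrB; elim: n {p} => [|n IH]; first by rewrite big_ord0 subrr.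
  by rewrite big_ord_recr /= IH addrA subrK.
have toS (m c : nat) : (c.+1%:Z - m%:Z)%:~R = (c%:Z - m%:Z)%:~R + 1 :> C.
  by rewrite -addn1 PoszD addrAC [LHS]intrD.
have natS (c : nat) : c.+1%:R = c%:R + 1 :> C by rewrite -natr1.
have qE a b : q a b = cocycle_mono k 'X^a 'X^b by rewrite /q cocycle_zD eqxx.
clearbody q; case: k q qE => n q qE.
  have {}qE a b : q a b = \sum_(c < n) (c%:Z - n%:Z)%:~R ^+ a * c%:R ^+ b.
    by rewrite qE /=; apply: eq_bigr => c _; rewrite !hornerXn.
  under eq_bigr do under eq_bigr do rewrite qE.
  rewrite qE (tel n (fun c => (c%:Z - n%:Z)%:~R) (fun c => c%:R)) //.
  by rewrite sub0r subrr.
have {}qE a b : q a b =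
    - \sum_(c < n.+1) c%:R ^+ a * (c%:Z - n.+1%:Z)%:~R ^+ b.
  by rewrite qE /=; congr (- _); apply: eq_bigr => c _; rewrite !hornerXn.
under eq_bigr do under eq_bigr do rewrite qE !mulNrn.
under eq_bigr do rewrite sumrN.
rewrite qE sumrN -opprD.
rewrite (tel n.+1 (fun c => c%:R) (fun c => (c%:Z - n.+1%:Z)%:~R)) //.
by rewrite opprB sub0r subrr NegzE opprK.
Qed.

End DiffOp.

(* Formal vectors  \sum_i x_i v_i  of (the completion of) V, as coefficient
   functions.  With v_k = e^(N zeta) zeta^(s-k), z = zeta^N and
   D = (1/N) zeta d/dzeta one has z v_k = v_(k-N) and
   D v_k = v_(k-1) + (s-k)/N v_k; both operators make sense on arbitrary
   coefficient functions.                                                     *)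
Section Vectors.
Variables (C : fieldType) (N : nat) (s : C).

Definition vect := int -> C^o.

Definition vunit (j : int) : vect := fun i => (i == j)%:R.

Definition Dact (x : vect) : vect :=
  fun i => x (i + 1) + (s - i%:~R) / N%:R * x i.

Definition polyDact (f : {poly C}) (x : vect) : vect :=
  \sum_(l < size f) f`_l *: iter l Dact x.

Definition diffop_act (A : diffop C) (x : vect) : vect :=
  \sum_(k <- msupp A) (fun i => polyDact A@_k x (i + k * N%:Z)).

(* Z x Z matrices: A v_j = \sum_i A_ij v_i. *)
Definition zmatrix := int -> int -> C.

Definition mx_diffop (A : diffop C) : zmatrix :=
  fun i j => diffop_act A (vunit j) i.

(* multiplication by zeta^n: v_j |-> v_(j-n) *)
Definition mx_zeta (n : int) : zmatrix := fun i j => (i == j - n)%:R.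

Definition lspan (w : nat -> vect) : set vect :=
  range (fun c : seq C => \sum_(k < size c) c`_k *: w k).

Definition charpol (q : 'rV[C]_N) : {poly C} := \prod_i ('X - (q 0 i)%:P).

Definition is_bessel_series (q : 'rV[C]_N) (Psi : vect) : Prop :=
  [/\ forall i : int, i < 0 -> Psi i = 0, Psi 0 = 1 &
      diffop_act (zD 0 (charpol q)) Psi = diffop_act (zD 1 1) Psi].

(* For \sum_i q_i - (N-1)/2 = s and C of characteristic 0 there is exactly one
   such series; xget selects it.                                              *)
Definition bessel_series (q : 'rV[C]_N) : vect :=
  xget 0 [set Psi | is_bessel_series q Psi].

Definition bessel_plane (q : 'rV[C]_N) : set vect :=
  lspan (fun k => iter k Dact (bessel_series q)).

(* Bases (w_0, w_-1, w_-2, ...) with w_-k = v_-k + \sum_(i > -k) w_(i,-k) v_i.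
   Linear independence is automatic from this triangular shape.               *)
Definition adapted_basis (P : set vect) (w : nat -> vect) : Prop :=
  [/\ lspan w = P, forall k, w k (- k%:Z) = 1 &
      forall k (i : int), i < - k%:Z -> w k i = 0].

Definition bessel_basis (q : 'rV[C]_N) : nat -> vect :=
  xget 0 [set w | adapted_basis (bessel_plane q) w].

End Vectors.

(* Indices i_0 > i_1 > ... of the semi-infinite monomials of charge 0. *)
Record maya := Maya {
  maya_seq :> nat -> int;
  maya_decr : forall k, maya_seq k.+1 < maya_seq k;
  maya_tail : exists n, forall k, (n <= k)%N -> maya_seq k = - k%:Z }.

HB.instance Definition _ := gen_eqMixin maya.
HB.instance Definition _ := gen_choiceMixin maya.

Lemma vacuum_decr (k : nat) : - k.+1%:Z < - k%:Z :> int.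
Proof. by rewrite ltrN2 ltz_nat. Qed.

Lemma vacuum_tail : exists n, forall k, (n <= k)%N -> - k%:Z = - k%:Z :> int.
Proof. by exists 0%N. Qed.

Definition vacuum_maya : maya := Maya vacuum_decr vacuum_tail.

Section Fock.
Variable C : fieldType.

(* The completion of F^(0): the formal combination \sum_I x_I v_I is the
   function I |-> x_I.                                                        *)
Definition fock := maya -> C^o.

Definition fin_fock : set fock := [set x | finite_set [set I | x I != 0]].

Definition fock_mono (I : maya) : fock := fun J => (J == I)%:R.

Definition vacuum : fock := fock_mono vacuum_maya.

Definition eventual_value (u : nat -> C) : C :=
  xget 0 [set c | exists m, forall n, (m <= n)%N -> u n = c].

(* w_0 /\ w_1 /\ w_2 /\ ... : its coefficient at v_(i_0) /\ v_(i_1) /\ ... is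
   the determinant of the coefficients of w_b at v_(i_a), that is the value at
   which the finite sections stabilize; they do so whenever, for large b, w_b
   is v_-b plus terms of higher index, the other w_b being bounded below.     *)
Definition wedge (w : nat -> vect C) : fock := fun I =>
  eventual_value (fun n => \det (\matrix_(a < n, b < n) w b (I a))).

(* coefficient of v_J in r(E_ij) v_I *)
Definition r_unit (i j : int) (I J : maya) : C :=
  \sum_(k \in [set: nat])
    wedge (fun b => if b == k then (I k == j)%:R *: vunit C i
                    else vunit C (I b)) J.

Definition rhat_unit (i j : int) (I J : maya) : C :=
  r_unit i j I J - ((i == j) && (j <= 0) && (J == I))%:R.

(* coefficient of v_J in \hat r(A) v_I *)
Definition rhat_coef (A : zmatrix C) (I J : maya) : C :=
  \sum_(p \in [set: int * int]) A p.1 p.2 * rhat_unit p.1 p.2 I J.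

(* The sums of finite support in r_unit and rhat_coef are finite for every A;
   the one below is finite when A has finitely many nonzero diagonals.        *)
Definition rhat (A : zmatrix C) (x : fock) : fock := fun J =>
  \sum_(I \in [set: maya]) x I * rhat_coef A I J.

Definition J_ (n : int) (x : fock) : fock := - rhat (mx_zeta C n) x.

(* C[[t_1,t_2,...]]: the coefficient of the monomial \prod_i t_(i+1)^(m i) of
   f is f m.  The index i : nat stands for the variable t_(i+1).              *)
Definition fps := {cmonom nat} -> C^o.

Definition polynomials : set fps := [set f | finite_set [set m | f m != 0]].

Definition fps1 : fps := fun m => (m == onecm nat)%:R.

Definition deriv_t (i : nat) (f : fps) : fps :=
  fun m => (m i).+1%:R * f (mulcm m (ucm i)).

Definition mul_t (i : nat) (f : fps) : fps :=
  fun m => if (0 < m i)%N then f (divcm m (ucm i)) else 0.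

(* sigma : F^(0) -> C[t_1,t_2,...] is the boson-fermion correspondence; its
   values outside F^(0) are irrelevant.                                       *)
Definition is_boson_fermion (sigma : fock -> fps) : Prop :=
  [/\ forall (a : C) x y, fin_fock x -> fin_fock y ->
        sigma (a *: x + y) = a *: sigma x + sigma y,
      set_bij fin_fock polynomials sigma,
      sigma vacuum = fps1,
      forall (n : nat) x, fin_fock x ->
        sigma (J_ n.+1%:Z x) = deriv_t n (sigma x) &
      forall (n : nat) x, fin_fock x ->
        sigma (J_ (- n.+1%:Z) x) = n.+1%:R *: mul_t n (sigma x)].

(* the extension of sigma to formal combinations of monomials *)
Definition completed (sigma : fock -> fps) (x : fock) : fps := fun m =>
  \sum_(I \in [set: maya]) x I * sigma (fock_mono I) m.

End Fock.

Section Representation.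
Variables (C : fieldType) (N : nat) (s : C).

Definition fock_act (gamma : diffop C -> C) (X : W1oo C) (x : fock C)
    : fock C :=
  rhat (mx_diffop N s X.1) x + (gamma X.1 + X.2 * N%:R) *: x.

(* gamma is linear and makes c |-> N, W(A) |-> \hat r(A) + gamma(A) Id a Lie
   algebra representation.  Exactly one gamma has this property, W_(1+oo) being
   perfect; likewise exactly one sigma on F^(0) satisfies is_boson_fermion.   *)
Definition is_W1oo_functional (gamma : diffop C -> C) : Prop :=
  (forall a A B, gamma (a *: A + B) = a * gamma A + gamma B) /\
  (forall X Y x, fock_act gamma (Wbracket X Y) x =
     fock_act gamma X (fock_act gamma Y x)
     - fock_act gamma Y (fock_act gamma X x)).

Variables (gamma : diffop C -> C) (sigma : fock C -> fps C).

Definition fps_act (X : W1oo C) (f : fps C) : fps C :=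
  completed sigma
    (fock_act gamma X ('pinv_(fun=> 0) [set: fock C] (completed sigma) f)).

Definition is_submodule (M : set (fps C)) : Prop :=
  [/\ M 0, forall (a : C) f g, M f -> M g -> M (a *: f + g) &
      forall X f, M f -> M (fps_act X f)].

Definition bessel_tau (q : 'rV[C]_N) : fps C :=
  completed sigma (wedge (bessel_basis s q)).

Definition bessel_module (q : 'rV[C]_N) : set (fps C) :=
  smallest is_submodule [set bessel_tau q].

Definition singular_vector (q : 'rV[C]_N) (f : fps C) : Prop :=
  [/\ bessel_module q f, f <> 0,
      ~ (exists a : C, f = a *: bessel_tau q),
      forall (k : int) (l : nat), 0 < k -> fps_act (L C k l) f = 0 &
      forall l : nat, exists a : C, fps_act (L C 0 l) f = a *: f].

End Representation.

(* Main.v *)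
(* Everything reduces to the Fock space, because the completed boson-fermion
   correspondence is injective: J_(-n) raises the energy by n, so sigma respects
   the grading by energy, whose pieces are finite-dimensional.

   Write P for P_r, Psi for Psi_r, Q = P / (D - r_2) and u = z^-1 Q(D) Psi.
   From (D - r_2) Q Psi = z Psi one gets (D + 1 - r_2) u = Psi, and the Darboux
   transform Psi' = (D - r_1) u = Psi - (alpha + 1) u solves the equation of
   r' = r + e_1 - e_2.  As (D + 1 - r_2) Psi' = (D - r_1) Psi, the two planes
   have bases which differ in the first vector only: Psi or Psi', followed by
   the (D - r_1) D^b Psi.  Since z^-1 P(D) acts on the plane by
   f(D) Psi |-> f(D + 1) Psi, the operator A sends Psi to Psi' - Psi and
   (D - r_1) D^b Psi to - (alpha + 1) (D + alpha + 1)^b Psi, a combination of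
   earlier basis vectors; so only the first factor contributes to \hat r(A) tau_r,
   and tau_r' = tau_r + \hat r(A) tau_r.

   An operator z^k f(D) with k >= 0 preserves the plane, hence acts on its tau
   function by a scalar; for k > 0 the scalar vanishes, W(z^k f(D)) being
   proportional to a commutator with W(D).                                    *)

Require Import Defs.
From mathcomp Require Import all_boot all_order all_algebra all_fingroup.
From mathcomp Require Import finmap all_classical reals.
From mathcomp.real_closed Require Import complex.
From mathcomp.multinomials Require Import monalg.
From mathcomp Require Import zify ring.
Set Implicit Arguments. Unset Strict Implicit. Unset Printing Implicit Defensive.
Import Order.TTheory GRing.Theory Num.Theory.
Local Open Scope classical_set_scope.
Local Open Scope ring_scope.

(** * Finitely supported sums and determinants *)

Section FiniteSums.
Variables (R : pzRingType) (T : choiceType).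
Implicit Types f g : T -> R.

Lemma fsbig_uniqE (r : seq T) f : uniq r -> (forall i, i \notin r -> f i = 0) ->
  \sum_(i \in [set: T]) f i = \sum_(i <- r) f i.
Proof.
move=> ur h.
rewrite (@fsbigE _ _ _ _ _ r) //; last by move=> i _; exact: h.
by apply: eq_bigl => i; rewrite in_setT.
Qed.

Definition fsupp f := [set i | f i != 0].

Lemma fsumE (A : set T) f : finite_set A -> fsupp f `<=` A ->
  \sum_(i \in [set: T]) f i = \sum_(i <- fset_set A) f i.
Proof.
move=> fA h; apply: fsbig_uniqE; first exact: fset_uniq.
move=> i; rewrite in_fset_set // => /negP iA; apply/eqP/negPn/negP => fi.
by apply: iA; rewrite inE; exact: h.
Qed.

Lemma fsumD f g : finite_set (fsupp f) -> finite_set (fsupp g) ->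
  \sum_(i \in [set: T]) (f i + g i) =
  \sum_(i \in [set: T]) f i + \sum_(i \in [set: T]) g i.
Proof.
move=> ff fg; have fU : finite_set (fsupp f `|` fsupp g) by rewrite finite_setU.
have sf : fsupp f `<=` fsupp f `|` fsupp g by move=> i; left.
have sg : fsupp g `<=` fsupp f `|` fsupp g by move=> i; right.
rewrite (fsumE fU sf) (fsumE fU sg) -big_split; apply: fsumE => // i /=.
have [fi|fi] := eqVneq (f i) 0; last by move=> _; left.
by rewrite /fsupp /= fi add0r; right.
Qed.

Lemma finite_fsupp_sum (K : Type) (r : seq K) (F : K -> T -> R) :
  (forall k, finite_set (fsupp (F k))) ->
  finite_set (fsupp (fun i => \sum_(k <- r) F k i)).
Proof.
move=> hF; elim: r => [|k r IH].
  rewrite (_ : fsupp _ = set0) //; apply/seteqP; split=> // i.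
  by rewrite /fsupp /= big_nil eqxx.
apply: (@sub_finite_set _ _ (fsupp (F k) `|`
    fsupp (fun i => \sum_(k <- r) F k i))); last by rewrite finite_setU.
move=> i; rewrite /fsupp /= big_cons.
have [->|?] := eqVneq (F k i) 0; last by left.
by rewrite add0r; right.
Qed.

Lemma fsum_sum (K : Type) (r : seq K) (F : K -> T -> R) :
  (forall k, finite_set (fsupp (F k))) ->
  \sum_(i \in [set: T]) (\sum_(k <- r) F k i) =
  \sum_(k <- r) (\sum_(i \in [set: T]) F k i).
Proof.
move=> hF; elim: r => [|k r IH].
  rewrite big_nil; apply: fsbig1 => i _; exact: big_nil.
rewrite big_cons -IH -fsumD //; last exact: finite_fsupp_sum.
by apply: eq_fsbigr => i _; rewrite big_cons.
Qed.

End FiniteSums.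

Lemma fsbig_natE (R : pzRingType) (f : nat -> R) n :
  (forall k, (n <= k)%N -> f k = 0) ->
  \sum_(k \in [set: nat]) f k = \sum_(k < n) f k.
Proof.
move=> h; rewrite (@fsbig_uniqE _ _ (iota 0 n)) ?iota_uniq //.
  by rewrite -(big_mkord xpredT) /index_iota subn0.
by move=> i; rewrite mem_iota add0n /= -leqNgt; exact: h.
Qed.

Section Determinants.
Variable C : fieldType.

(** The entries are indexed by [nat], so that finite sections of different sizes come from one and
    the same function. *)
Definition detn n (f : nat -> nat -> C) : C := \det (\matrix_(a < n, b < n) f a b).

Lemma eq_detn n (f g : nat -> nat -> C) :
  (forall a b, (a < n)%N -> (b < n)%N -> f a b = g a b) -> detn n f = detn n g.
Proof. by move=> h; congr (\det _); apply/matrixP => a b; rewrite !mxE h. Qed.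

Lemma detn_tr n f : detn n f = detn n (fun a b => f b a).
Proof.
by rewrite /detn -det_tr; congr (\det _); apply/matrixP => a b; rewrite !mxE.
Qed.

Lemma detn_step n f : (forall b, (b < n)%N -> f n b = 0) -> f n n = 1 ->
  detn n.+1 f = detn n f.
Proof.
move=> f0 f1; rewrite /detn (expand_det_row _ ord_max) (bigD1 ord_max) //=.
rewrite big1 ?addr0; last first.
  move=> b /negbTE hb; rewrite mxE f0 ?mul0r // ltn_neqAle -ltnS ltn_ord andbT.
  by apply/eqP => e; move/eqP: hb; apply; apply/val_inj.
rewrite mxE f1 mul1r /cofactor addnn -signr_odd odd_double expr0 mul1r.
by congr (\det _); apply/matrixP => a b; rewrite !mxE !lift_max.
Qed.

(** From row [m] on the matrix is upper unitriangular, so expansion along the last row removes that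
    row. This is what makes the finite sections of a semi-infinite wedge product stabilize. *)
Lemma detn_stable m n f : (m <= n)%N ->
  (forall a b, (m <= a)%N -> (b < a)%N -> f a b = 0) ->
  (forall a, (m <= a)%N -> f a a = 1) ->
  detn n f = detn m f.
Proof.
move=> mn f0 f1; elim: n mn => [|n IH]; first by rewrite leqn0 => /eqP ->.
rewrite leq_eqVlt => /orP[/eqP ->//|]; rewrite ltnS => mn.
by rewrite detn_step ?IH //; [move=> b; exact: f0|exact: f1].
Qed.

Lemma detn_row_eq n f k l : (k < n)%N -> (l < n)%N -> k <> l ->
  (forall b, f k b = f l b) -> detn n f = 0.
Proof.
move=> kn ln kl h; apply: (@determinant_alternate _ _ _ (Ordinal kn) (Ordinal ln)).
  by apply/eqP => -[].
by move=> b; rewrite !mxE /= h.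
Qed.

Lemma detn_col_eq n f k l : (k < n)%N -> (l < n)%N -> k <> l ->
  (forall a, f a k = f a l) -> detn n f = 0.
Proof. by rewrite detn_tr => kn ln kl h; exact: (detn_row_eq kn ln kl). Qed.

Lemma detn_row0 n f k : (k < n)%N ->
  (forall b, (b < n)%N -> f k b = 0) -> detn n f = 0.
Proof.
move=> kn h; rewrite /detn (expand_det_row _ (Ordinal kn)) big1 // => b _.
by rewrite mxE h // mul0r.
Qed.

Lemma detn_neq0 n f : detn n f != 0 ->
  exists s : {perm 'I_n}, forall a : 'I_n, f a (s a) != 0.
Proof.
move=> h; apply: contrapT => /forallNP hs; move/eqP: h; apply.
rewrite /detn /determinant big1 // => s _.
have /existsNP[a /negP] := hs s; rewrite negbK => /eqP fa.
by rewrite (bigD1 a) //= mxE fa mul0r mulr0.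
Qed.

Lemma detn_row_perm n (s : {perm 'I_n}) (f g : nat -> nat -> C) :
  (forall a b : 'I_n, f a b = g (s a) b) ->
  detn n f = (-1) ^+ s * detn n g.
Proof.
move=> h; rewrite /detn -det_perm -det_mulmx -row_permE; congr (\det _).
by apply/matrixP => a b; rewrite !mxE h.
Qed.

(** The replacement [f'] is a whole matrix of which only row [k] is used; summing the determinants
    over [k] gives the derivative of [\det] at [f] in the direction [f']. *)
Definition row_upd k (f' f : nat -> nat -> C) a b :=
  if a == k then f' a b else f a b.
Definition col_upd k (f' f : nat -> nat -> C) a b :=
  if b == k then f' a b else f a b.

Lemma detn_row_upd n (k : 'I_n) f' f : detn n (row_upd k f' f) =
  \sum_(b < n) f' k b * cofactor (\matrix_(a < n, b < n) f a b) k b.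
Proof.
rewrite /detn (expand_det_row _ k); apply: eq_bigr => b _.
rewrite mxE /row_upd eqxx; congr (_ * (_ * \det _)).
apply/matrixP => x y; rewrite !mxE ifF //.
by apply/negbTE; rewrite (inj_eq val_inj) eq_sym neq_lift.
Qed.

Lemma detn_col_upd n (k : 'I_n) f' f : detn n (col_upd k f' f) =
  \sum_(a < n) f' a k * cofactor (\matrix_(a < n, b < n) f a b) a k.
Proof.
rewrite /detn (expand_det_col _ k); apply: eq_bigr => a _.
rewrite mxE /col_upd eqxx; congr (_ * (_ * \det _)).
apply/matrixP => x y; rewrite !mxE ifF //.
by apply/negbTE; rewrite (inj_eq val_inj) eq_sym neq_lift.
Qed.

(* Both sides are the trace of [f'] times the adjugate of [f]. *)
Lemma detn_row_col n f' f :
  \sum_(k < n) detn n (row_upd k f' f) = \sum_(k < n) detn n (col_upd k f' f).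
Proof.
under eq_bigr do rewrite detn_row_upd.
by rewrite exchange_big; apply: eq_bigr => k _; rewrite detn_col_upd.
Qed.

Lemma detn_row_upd_sum n k f (K : Type) (r : seq K) (c : K -> nat -> C)
    (g : K -> nat -> nat -> C) : (k < n)%N ->
  detn n (row_upd k (fun a b => \sum_(j <- r) c j a * g j a b) f) =
  \sum_(j <- r) c j k * detn n (row_upd k (g j) f).
Proof.
move=> kn; rewrite (detn_row_upd (Ordinal kn)).
under [RHS]eq_bigr do rewrite (detn_row_upd (Ordinal kn)) mulr_sumr.
rewrite exchange_big; apply: eq_bigr => b _ /=.
by rewrite mulr_suml; apply: eq_bigr => j _; rewrite mulrA.
Qed.

Lemma detn_col_upd_sum n k f (K : Type) (r : seq K) (c : K -> nat -> C)
    (g : K -> nat -> nat -> C) : (k < n)%N ->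
  detn n (col_upd k (fun a b => \sum_(j <- r) c j b * g j a b) f) =
  \sum_(j <- r) c j k * detn n (col_upd k (g j) f).
Proof.
move=> kn; rewrite (detn_col_upd (Ordinal kn)).
under [RHS]eq_bigr do rewrite (detn_col_upd (Ordinal kn)) mulr_sumr.
rewrite exchange_big; apply: eq_bigr => b _ /=.
by rewrite mulr_suml; apply: eq_bigr => j _; rewrite mulrA.
Qed.

(** The hypotheses say [g = f u] with [u] upper unitriangular, hence of determinant [1]. *)
Lemma detn_unitri n (f u g : nat -> nat -> C) :
  (forall c b, (b < c)%N -> u c b = 0) -> (forall b, u b b = 1) ->
  (forall a b, (b < n)%N -> g a b = \sum_(c < n) f a c * u c b) ->
  detn n g = detn n f.
Proof.
move=> u0 u1 h.
suff -> : detn n g = detn n f * detn n u.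
  rewrite (_ : detn n u = 1) ?mulr1 //.
  rewrite (@detn_stable 0 n u) //; first exact: det_mx00.
  by move=> a b _; exact: u0.
rewrite /detn -det_mulmx; congr (\det _); apply/matrixP => a b.
by rewrite !mxE h //; apply: eq_bigr => c _; rewrite !mxE.
Qed.

End Determinants.

(** * Semi-infinite wedge products *)

Lemma maya_lt (J : maya) a b : (a < b)%N -> J b < J a.
Proof.
elim: b => [//|b IH]; rewrite ltnS leq_eqVlt => /orP[/eqP ->|/IH h].
  exact: maya_decr.
exact: lt_trans (maya_decr J b) h.
Qed.

Lemma maya_inj (J : maya) : injective J.
Proof.
by move=> a b e; have [/(maya_lt J)|/(maya_lt J)|//] := ltngtP a b; rewrite e ltxx.
Qed.

Lemma maya_le0 (J : maya) k : J k <= J 0%N.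
Proof. by case: k => // k; apply/ltW/maya_lt. Qed.

Lemma maya_shift_le (J : maya) a b : (a <= b)%N -> J b + b%:Z <= J a + a%:Z.
Proof.
move=> /subnK <-; elim: (b - a)%N => [|d IH]; first by rewrite add0n.
by have := maya_decr J (d + a); move: IH; rewrite addSn; lia.
Qed.

(** The sequence [J k + k] is nonincreasing and eventually zero. *)
Lemma maya_ge (J : maya) k : - k%:Z <= J k.
Proof.
have [n hn] := maya_tail J; have := maya_shift_le J (leq_maxr n k).
by rewrite hn ?leq_maxl //; lia.
Qed.

Lemma maya_ext (I J : maya) : (forall k, I k = J k) -> I = J.
Proof.
case: I J => [I Id It] [J Jd Jt] /= /funext e; subst J.
by congr Maya; exact: Prop_irrelevance.
Qed.

Definition has_tail m (S : nat -> int) := forall a, (m <= a)%N -> S a = - a%:Z.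

Lemma has_tailW m n S : (m <= n)%N -> has_tail m S -> has_tail n S.
Proof. by move=> mn h a na; apply: h; exact: leq_trans na. Qed.

(** Only the first [m] values have to be sorted: by injectivity they all exceed [- m], so the sorted
    list can be followed by the tail. The permutation later supplies the sign of the unsorted
    monomial. *)
Lemma sort_maya m (S : nat -> int) : has_tail m S -> injective S ->
  exists (I : maya) (s : {perm 'I_m}),
    has_tail m I /\ forall a : 'I_m, S a = I (s a).
Proof.
move=> tS iS; pose t : m.-tuple int := [tuple S a | a < m].
pose u := sort (fun x y : int => y <= x) t.
have pu : perm_eq u t by rewrite /u perm_sort.
have su : size u = m by rewrite (perm_size pu) size_tuple.
have srt : sorted (fun x y : int => y <= x) u.
  by apply: sort_sorted => x y; rewrite le_total.
have uu : uniq u.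
  rewrite (perm_uniq pu) map_inj_uniq ?enum_uniq //.
  by move=> a b /iS /val_inj.
(* A value [x <= - m] is already taken by the tail at position [- x]. *)
have memu x : x \in u -> - m%:Z < x.
  rewrite (perm_mem pu) => /mapP[a _ ->].
  have am := ltn_ord a; rewrite ltNge; apply/negP => h.
  have h' : (m <= absz (S a))%N by lia.
  have : S a = S (absz (S a)) by rewrite [RHS]tS //; lia.
  by move/iS => e; move: am; rewrite e ltnNge h'.
pose I a := if (a < m)%N then nth 0 u a else - a%:Z.
have Id a : I a.+1 < I a.
  rewrite /I; have [am|ma] := ltnP a.+1 m.
    rewrite ltnW // lt_neqAle; apply/andP; split.
      by rewrite nth_uniq ?su // ?(ltnW am) // gtn_eqF.
    have tr : transitive (fun x y : int => y <= x).
      by move=> y x z h1 h2; exact: le_trans h2 h1.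
    have := sorted_leq_nth tr (fun x => lexx x) 0 srt.
    by move=> /(_ a a.+1); rewrite !inE su; apply => //; exact: ltnW.
  case: ifP => am; last by lia.
  have := memu (nth 0 u a); rewrite mem_nth ?su // => /(_ isT).
  by have -> : m = a.+1 by apply/eqP; rewrite eqn_leq ma am.
have It : exists n, forall k, (n <= k)%N -> I k = - k%:Z.
  by exists m => k mk; rewrite /I ltnNge mk.
have /tuple_permP[p ep] : perm_eq u t by [].
exists (Maya Id It), (p^-1)%g; split=> [a ma|a] /=; first by rewrite /I ltnNge ma.
rewrite /I ltn_ord ep (nth_map a) ?size_enum_ord // tnth_mktuple.
by rewrite nth_ord_enum permKV.
Qed.

Section Wedge.
Variable C : fieldType.
Implicit Types (w : nat -> vect C) (S : nat -> int) (I J : maya).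

Lemma eventual_valueE (u : nat -> C) c m :
  (forall n, (m <= n)%N -> u n = c) -> eventual_value u = c.
Proof.
move=> h; apply: xget_unique; first by exists m.
move=> c' [m' h']; rewrite -(h (maxn m m')) ?leq_maxl //.
by rewrite h' ?leq_maxr.
Qed.

(** The sequence [S] need be neither decreasing nor injective: exchanging one index of a Maya
    diagram for another leads to unsorted sequences, possibly with repetitions. *)
Definition wdet w S n : C := @detn C n (fun a b => w b (S a)).

Definition wedge_at w S : C := @eventual_value C (wdet w S).

Lemma wedgeE w I : wedge w I = wedge_at w I :> C. Proof. by []. Qed.

Definition unitriangular w :=
  (forall b, w b (- b%:Z) = 1) /\ (forall b (i : int), i < - b%:Z -> w b i = 0).

Lemma wedge_atE w S m : unitriangular w -> has_tail m S ->
  forall n, (m <= n)%N -> wedge_at w S = wdet w S n.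
Proof.
move=> [w1 w0] tS n mn; rewrite /wedge_at (@eventual_valueE _ (wdet w S m) m).
  apply/esym/detn_stable => // [a b ma ba|a ma]; rewrite tS // w0 //; lia.
move=> k mk; apply: detn_stable => // [a b ma ba|a ma]; rewrite tS // w0 //; lia.
Qed.

Lemma wedge_at_eq w S k l : k <> l -> S k = S l -> wedge_at w S = 0.
Proof.
move=> kl e; apply: (@eventual_valueE _ _ (maxn k l).+1) => n.
rewrite gtn_max => /andP[kn ln].
by apply: (detn_row_eq kn ln kl) => b; rewrite e.
Qed.

Definition mvect I : nat -> vect C := fun b => vunit C (I b).

(** A monomial is in general not [unitriangular], so its sections need their own argument: where [S]
    and [I] share the tail, the rows are those of the identity matrix. *)
Lemma wedge_mvectE S I m : has_tail m S -> has_tail m I ->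
  forall n, (m <= n)%N -> wedge_at (mvect I) S = wdet (mvect I) S n.
Proof.
move=> tS tI n mn.
have h k : (m <= k)%N -> wdet (mvect I) S k = wdet (mvect I) S m.
  move=> mk; apply: detn_stable => // [a b ma ba|a ma].
    rewrite /mvect /vunit tS // -tI // (inj_eq (@maya_inj I)).
    by rewrite gtn_eqF.
  by rewrite /mvect /vunit tS // tI // eqxx.
by rewrite h //; exact: eventual_valueE h.
Qed.

Lemma wdet_mvect_neq0 S I n : wdet (mvect I) S n != 0 ->
  exists s : {perm 'I_n}, forall a : 'I_n, S a = I (s a).
Proof.
move=> /detn_neq0[s hs]; exists s => a; have := hs a.
by rewrite /mvect /vunit; case: (S a =P _) => // _; rewrite eqxx.
Qed.

(** The first [m] values of [I] and of [J] form the same set, and a finite set has only one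
    decreasing enumeration. *)
Lemma maya_perm_eq I J m (s : {perm 'I_m}) : has_tail m I -> has_tail m J ->
  (forall a : 'I_m, I a = J (s a)) -> I = J.
Proof.
move=> tI tJ h; apply: maya_ext => k.
have [km|mk] := ltnP k m; last by rewrite tI ?tJ.
pose sq (K : maya) := [seq K a | a <- iota 0 m].
have srt K : sorted (fun x y : int => y < x) (sq K).
  apply: (homo_sorted (e := ltn)); last exact: iota_ltn_sorted.
  by move=> a b; exact: maya_lt.
suff : sq I = sq J.
  by move/(congr1 (nth 0 ^~ k)); rewrite !(nth_map 0%N) ?size_iota // nth_iota.
have tr : transitive (fun x y : int => y < x).
  by move=> y x z h1 h2; exact: lt_trans h2 h1.
apply: (irr_sorted_eq tr _ (srt I) (srt J)) => x; first exact: ltxx.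
apply/mapP/mapP => -[a]; rewrite mem_iota add0n /= => am ->.
  exists (val (s (Ordinal am))); first by rewrite mem_iota /= ltn_ord.
  exact: (h (Ordinal am)).
exists (val ((s^-1)%g (Ordinal am))); first by rewrite mem_iota /= ltn_ord.
by rewrite h permKV.
Qed.

Lemma common_tail m I J : exists n, [/\ (m <= n)%N, has_tail n I & has_tail n J].
Proof.
have [a ha] := maya_tail I; have [b hb] := maya_tail J.
exists (maxn m (maxn a b)); split; first exact: leq_maxl.
  by apply: (has_tailW _ ha); rewrite leq_max leq_maxl orbT.
by apply: (has_tailW _ hb); rewrite leq_max leq_maxr orbT.
Qed.

Lemma wedge_mvect I J : wedge_at (mvect I) J = (J == I)%:R.
Proof.
have [n [_ tI tJ]] := common_tail 0 I J.
rewrite (wedge_mvectE tJ tI (leqnn n)); have [->|/eqP IJ] := eqVneq J I.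
  rewrite /wdet (@detn_stable _ 0 n) // /mvect /vunit.
  - exact: det_mx00.
  - by move=> a b _ ba; rewrite (inj_eq (@maya_inj I)) gtn_eqF.
  - by move=> a _; rewrite eqxx.
apply/eqP/negPn/negP => /wdet_mvect_neq0[s hs]; apply: IJ.
exact: (maya_perm_eq tJ tI hs).
Qed.

Lemma wedge_mvect_sort m S I0 (s : {perm 'I_m}) I : has_tail m S ->
  injective S -> has_tail m I0 -> (forall a : 'I_m, S a = I0 (s a)) ->
  wedge_at (mvect I) S = (-1) ^+ s * (I == I0)%:R.
Proof.
move=> tS iS tI0 hs; have [->|/eqP II0] := eqVneq I I0.
  rewrite (wedge_mvectE tS tI0 (leqnn m)).
  transitivity ((-1) ^+ s * wdet (mvect I0) I0 m).
    by apply: detn_row_perm => a b; rewrite hs.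
  by rewrite -(wedge_mvectE tI0 tI0 (leqnn m)) wedge_mvect eqxx.
rewrite mulr0; apply/eqP/negPn/negP => h; apply: II0.
have [n [mn tI _]] := common_tail m I I.
have tS' := has_tailW mn tS.
rewrite (wedge_mvectE tS' tI (leqnn n)) in h.
have [s' hs'] := wdet_mvect_neq0 h.
(* The sorting permutation is extended from [m] to [n] positions by the identity. *)
have hlift : forall a : 'I_n, exists b : 'I_n, S a = I0 b.
  move=> a; have [am|ma] := ltnP a m; last by exists a; rewrite tS // tI0.
  by exists (Ordinal (leq_trans (ltn_ord (s (Ordinal am))) mn)); rewrite /= -hs.
have [p hp] := choice hlift.
have ip : injective p by move=> a b e; apply/val_inj/iS; rewrite !hp e.
apply: (@maya_perm_eq _ _ _ (s'^-1 * perm ip)%g tI (has_tailW mn tI0)) => a.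
by rewrite permM permE -hp hs' permKV.
Qed.

Lemma not_injective (S : nat -> int) :
  ~ injective S -> exists k l, k <> l /\ S k = S l.
Proof.
move=> niS; apply: contrapT => h; apply: niS => k l e.
by apply: contrapT => kl; apply: h; exists k, l.
Qed.

(** At most the monomial obtained by sorting [S] contributes. This finiteness lets the sum over Maya
    diagrams be exchanged with finite sums. *)
Lemma wedge_mvect_supp m S : has_tail m S ->
  finite_set (fsupp (fun I => wedge_at (mvect I) S)).
Proof.
move=> tS; have [iS|/not_injective[k [l [kl e]]]] := pselect (injective S).
  have [I0 [s [tI hs]]] := sort_maya tS iS.
  apply: (@sub_finite_set _ _ [set I0]) => // I; rewrite /fsupp /=.
  rewrite (wedge_mvect_sort _ tS iS tI hs).
  by case: (I =P I0) => // _; rewrite mulr0 eqxx.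
rewrite (_ : fsupp _ = set0) //; apply/seteqP; split=> // I.
by rewrite /fsupp /= (wedge_at_eq _ kl e) eqxx.
Qed.

(* Pairing [wedge w] with the coefficient functional of the unsorted monomial
   [v_(S 0) /\ v_(S 1) /\ ...]. *)
Lemma wedge_pairing w m S : unitriangular w -> has_tail m S ->
  \sum_(I \in [set: maya]) wedge w I * wedge_at (mvect I) S = wedge_at w S.
Proof.
move=> tw tS.
have [iS|/not_injective[k [l [kl e]]]] := pselect (injective S); last first.
  rewrite (wedge_at_eq _ kl e) fsbig1 // => I _.
  by rewrite (wedge_at_eq _ kl e) mulr0.
have [I0 [s [tI hs]]] := sort_maya tS iS.
have E I := wedge_mvect_sort I tS iS tI hs.
rewrite (@fsbig_uniqE _ _ [:: I0]) //; last first.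
  by move=> I; rewrite inE E => /negbTE ->; rewrite !mulr0.
rewrite big_seq1 E eqxx mulr1 wedgeE mulrC.
rewrite (wedge_atE tw tI (leqnn m)) (wedge_atE tw tS (leqnn m)).
by symmetry; apply: detn_row_perm => a b; rewrite hs.
Qed.

End Wedge.

(** * The action of infinite matrices on wedge products *)

Section RHat.
Variable C : fieldType.
Implicit Types (w : nat -> vect C) (S : nat -> int) (I J : maya).

Definition upd S k j : nat -> int := fun a => if a == k then j else S a.

Lemma upd_id S k : upd S k (S k) = S.
Proof. by apply/funext => a; rewrite /upd; case: eqP => [->|]. Qed.

Lemma has_tail_upd m n S k j :
  has_tail m S -> (m <= n)%N -> (k < n)%N -> has_tail n (upd S k j).
Proof.
move=> tS mn kn a na; rewrite /upd ifF; first by apply: tS; exact: leq_trans na.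
by rewrite gtn_eqF // (leq_trans kn).
Qed.

(** The definition replaces one factor of the source [v_I]; by [detn_row_col] one index of the
    target [J] can be replaced instead. In this form [I] enters only through a pairing with [v_I],
    which can be summed against the coefficients of a wedge product. *)
Lemma r_unitE i j I J : r_unit C i j I J =
  \sum_(k \in [set: nat]) (J k == i)%:R * wedge_at (mvect C I) (upd J k j) :> C.
Proof.
(* The bound keeps the tail beyond [n] away from both [i] and [j], so that both sums stop at [n]. *)
have [n [nij tI tJ]] := common_tail (`|i| + `|j|).+1 I J.
have ne (x : int) (a : nat) : (`|x| <= `|i| + `|j|)%N -> (n <= a)%N ->
    (- a%:Z == x) = false by move=> hx na; apply/eqP; lia.
rewrite [LHS](@fsbig_natE C^o _ n); last first.
  move=> k nk; rewrite tI // ne ?leq_addl // scale0r.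
  apply: (@eventual_valueE C _ _ k.+1) => p kp.
  change (detn p (fun a b =>
    (if b == k then (0 : vect C) else vunit C (I b)) (J a)) = 0).
  by rewrite detn_tr; apply: (detn_row0 kp) => b _; rewrite eqxx.
rewrite (@fsbig_natE C _ n); last first.
  by move=> k nk; rewrite tJ // ne ?leq_addr // mul0r.
pose f a b : C := (J a == I b)%:R.
pose f' a b : C := (I b == j)%:R * (J a == i)%:R.
transitivity (\sum_(k < n) detn n (col_upd k f' f)).
  apply: eq_bigr => k _.
  transitivity (wdet (fun b => if b == k then (I k == j)%:R *: vunit C i
                 else vunit C (I b)) J n).
    apply: (@eventual_valueE C _ _ n) => p np; apply: detn_stable => // a.
      move=> b na ba; rewrite tJ //; have [_|_] := eqVneq b k.
        change ((I k == j)%:R * (- a%:Z == i)%:R = 0 :> C).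
        by rewrite ne ?leq_addr // mulr0.
      by rewrite /vunit -tI // (inj_eq (@maya_inj I)) gtn_eqF.
    move=> na; rewrite tJ // /vunit ifF; first by rewrite tI // eqxx.
    by rewrite gtn_eqF // (leq_trans (ltn_ord k)).
  apply: eq_detn => a b _ _; rewrite /col_upd /f' /f.
  by case: eqP => [->|] //.
rewrite -detn_row_col; apply: eq_bigr => k _.
rewrite (wedge_mvectE C (has_tail_upd j tJ (leqnn n) (ltn_ord k)) tI (leqnn n)).
transitivity (detn n (row_upd k
    (fun a b => \sum_(t <- [:: tt]) (J a == i)%:R * (I b == j)%:R) f)).
  by apply: eq_detn => a b _ _; rewrite /row_upd big_seq1 /f' mulrC.
rewrite (detn_row_upd_sum _ _ (fun t a => (J a == i)%:R)
  (fun t a b => (I b == j)%:R)) //.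
rewrite big_seq1; congr (_ * _); apply: eq_detn => a b _ _.
by rewrite /row_upd /mvect /vunit /upd; case: eqP => // _; rewrite eq_sym.
Qed.

Definition banded (d : nat) (A : zmatrix C) :=
  forall i j, A i j != 0 -> (`|i - j| <= d)%N.

Definition win B : seq int := [seq t%:Z - B%:Z | t <- iota 0 (2 * B).+1].

Lemma mem_win B (x : int) : (x \in win B) = (`|x| <= B)%N.
Proof.
apply/mapP/idP => [[t]|xB]; first by rewrite mem_iota => h ->; lia.
by exists (absz (x + B%:Z)); rewrite ?mem_iota; lia.
Qed.

Lemma win_uniq B : uniq (win B).
Proof. by rewrite map_inj_uniq ?iota_uniq // => a b; lia. Qed.

Lemma r_unit_diag i I J : r_unit C i i I J =
  (J == I)%:R * \sum_(k \in [set: nat]) ((J k == i)%:R : C).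
Proof.
rewrite r_unitE mulr_fsumr; apply: eq_fsbigr => k _ /=.
have [<-|_] := eqVneq (J k) i; last by rewrite mul0r mulr0.
by rewrite upd_id wedge_mvect mulrC.
Qed.

Lemma maya_count J k :
  \sum_(a \in [set: nat]) ((J a == J k)%:R : C) = 1.
Proof.
rewrite (@fsbig_uniqE _ _ [:: k]) //; first by rewrite big_seq1 eqxx.
by move=> a; rewrite inE (inj_eq (@maya_inj J)) => /negbTE ->.
Qed.

(** Far from the origin, a diagonal unit meets either an occupied index [<= 0], where normal
    ordering cancels it, or an empty positive one. An off-diagonal unit would replace an entry of
    [J] by an index that the tail of [J] already contains. *)
Lemma rhat_unit_supp d m B i j I J : has_tail m J ->
  (m + d + `|J 0%N| <= B)%N -> (`|i - j| <= d)%N ->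
  rhat_unit C i j I J != 0 -> (i \in win B) && (j \in win B).
Proof.
move=> tJ hB ijd; apply: contraNT => hw; rewrite /rhat_unit; apply/eqP.
have [eij|nij] := eqVneq i j.
  subst j; rewrite r_unit_diag /= andbb in hw *; rewrite mem_win -ltnNge in hw.
  have [_|_] := eqVneq J I; last by rewrite mul0r andbF subrr.
  rewrite mul1r andbT; have [i0|i0] := leP i 0.
    have -> : i = J `|i|%N by rewrite tJ; lia.
    by rewrite maya_count subrr.
  rewrite fsbig1 ?subrr // => k _; have h := maya_le0 J k.
  by case: eqP => // e; exfalso; lia.
rewrite /= subr0 r_unitE fsbig1 // => k _.
have [e|] := eqVneq (J k) i; last by rewrite mul0r.
have Jk := maya_le0 J k; rewrite !mem_win in hw.
have jJ : j = J `|j|%N by rewrite tJ; lia.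
rewrite (@wedge_at_eq _ _ _ k `|j|%N) ?mulr0 //.
  by move=> ek; move: nij; rewrite -e jJ ek eqxx.
by rewrite /upd eqxx; case: eqP => [|_].
Qed.

Lemma rhat_coefE d m A B I J : banded d A -> has_tail m J ->
  (m + d + `|J 0%N| <= B)%N ->
  rhat_coef A I J =
    \sum_(k < B.+1) \sum_(j <- win B) A (J k) j * wedge_at (mvect C I) (upd J k j)
    - (J == I)%:R * \sum_(b < B.+1) A (- b%:Z) (- b%:Z) :> C.
Proof.
move=> bA tJ hB; rewrite /rhat_coef.
rewrite (@fsbig_uniqE C _ [seq (i, j) | i <- win B, j <- win B]); last 2 first.
- by apply: allpairs_uniq; rewrite ?win_uniq // => -[? ?] [].
- move=> [i j]; apply: contraNeq; rewrite mulf_eq0 negb_or => /andP[Aij h].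
  have /andP[iw jw] := rhat_unit_supp tJ hB (bA _ _ Aij) h.
  exact: allpairs_f.
rewrite big_allpairs /=.
under eq_bigr do under eq_bigr do rewrite /rhat_unit mulrBr.
under eq_bigr do rewrite sumrB.
rewrite sumrB; congr (_ - _).
  transitivity (\sum_(i <- win B) \sum_(j <- win B) \sum_(k < B.+1)
      (J k == i)%:R * (A i j * wedge_at (mvect C I) (upd J k j))).
    apply: eq_big_seq => i iw; apply: eq_bigr => j _.
    rewrite r_unitE (@fsbig_natE C _ B.+1).
      by rewrite mulr_sumr; apply: eq_bigr => k _; rewrite mulrCA.
    move=> k Bk; rewrite tJ; last by lia.
    by case: eqP => [e|]; [exfalso; move: iw; rewrite mem_win; lia|rewrite mul0r].
  transitivity (\sum_(i <- win B) \sum_(k < B.+1) \sum_(j <- win B)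
      (J k == i)%:R * (A i j * wedge_at (mvect C I) (upd J k j))).
    by apply: eq_bigr => i _; exact: exchange_big.
  rewrite exchange_big; apply: eq_bigr => k _ /=.
  have Jkw : J k \in win B.
    rewrite mem_win; have := ltn_ord k; have := maya_le0 J k.
    by have := maya_ge J k; lia.
  rewrite (bigD1_seq _ Jkw (win_uniq B)) /= [X in _ + X]big1 ?addr0; last first.
    by move=> i /negbTE h; rewrite big1 // => j _; rewrite eq_sym h mul0r.
  by apply: eq_bigr => j _; rewrite eqxx mul1r.
(* Normal ordering subtracts the diagonal entries at indices [i <= 0], which inside the window are
   [0, -1, ..., -B]. *)
transitivity ((J == I)%:R * \sum_(i <- win B | i <= 0) A i i).
  rewrite mulr_sumr [RHS]big_mkcond; apply: eq_big_seq => i iw.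
  rewrite (bigD1_seq _ iw (win_uniq B)) /= [X in _ + X]big1 ?addr0; last first.
    by move=> j /negbTE h; rewrite eq_sym h mulr0.
  by rewrite eqxx; case: (i <= 0); rewrite ?mulr0 //= mulrC.
congr (_ * _).
transitivity (\sum_(i <- [seq - b%:Z | b : nat <- index_iota 0 B.+1]) A i i); last first.
  by rewrite big_map big_mkord.
rewrite -big_filter /index_iota subn0.
apply: perm_big; apply: uniq_perm.
- by rewrite filter_uniq // win_uniq.
- by rewrite map_inj_uniq ?iota_uniq // => a b; lia.
move=> x; rewrite mem_filter mem_win; apply/andP/mapP => [[x0 xB]|[b]].
  by exists `|x|%N; rewrite ?mem_iota; lia.
by rewrite mem_iota => h ->; lia.
Qed.

(* The finite sections compute the regularized trace exactly: beyond [B] the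
   matrix moves a vector of [J] either onto another one or onto an index where
   all [w b], [b <= B], vanish, and diagonal terms cancel the normal ordering. *)
Lemma rhat_wedge_row d m A B w J : unitriangular w -> banded d A ->
  has_tail m J -> (m + d + `|J 0%N| <= B)%N ->
  rhat A (wedge w) J =
    \sum_(k < B.+1) detn B.+1 (row_upd k
       (fun a b => \sum_(j <- win B) A (J a) j * w b j) (fun a b => w b (J a)))
    - (\sum_(b < B.+1) A (- b%:Z) (- b%:Z)) * wedge w J :> C.
Proof.
move=> tw bA tJ hB; rewrite /rhat.
have mB : (m <= B.+1)%N by lia.
have fin (k : 'I_B.+1) j : finite_set (fsupp (fun I =>
    wedge w I * (A (J k) j * wedge_at (mvect C I) (upd J k j)))).
  apply: sub_finite_set (wedge_mvect_supp C (has_tail_upd j tJ mB (ltn_ord k))).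
  by move=> I; apply: contra_neq => ->; rewrite !mulr0.
pose c := \sum_(b < B.+1) A (- b%:Z) (- b%:Z).
transitivity (\sum_(I \in [set: maya])
   (\sum_(k < B.+1) \sum_(j <- win B)
      wedge w I * (A (J k) j * wedge_at (mvect C I) (upd J k j))
    + (- c) * (wedge w I * (J == I)%:R))).
  apply: eq_fsbigr => I _; rewrite (rhat_coefE _ bA tJ hB) mulrBr; congr (_ + _).
    by rewrite mulr_sumr; apply: eq_bigr => k _; rewrite mulr_sumr.
  by rewrite -/c mulNr; congr (- _); rewrite mulrA mulrC.
rewrite fsumD; last 2 first.
- by apply: finite_fsupp_sum => k; apply: finite_fsupp_sum => j; exact: fin.
- apply: (@sub_finite_set _ _ [set J]) => // I; rewrite /fsupp /=.
  by case: (J =P I) => [->//|_]; rewrite !mulr0 eqxx.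
congr (_ + _).
  rewrite fsum_sum; last by move=> k; apply: finite_fsupp_sum => j; exact: fin.
  apply: eq_bigr => k _; rewrite fsum_sum; last by move=> j; exact: fin.
  rewrite (detn_row_upd_sum _ _ (fun j a => A (J a) j) (fun j a b => w b j)) //.
  apply: eq_bigr => j _.
  under eq_fsbigr do rewrite mulrCA.
  have tU := has_tail_upd j tJ mB (ltn_ord k).
  rewrite -mulr_fsumr (wedge_pairing tw tU) (wedge_atE tw tU (leqnn _)).
  congr (_ * _); apply: eq_detn => a b _ _; rewrite /row_upd /upd.
  by case: eqP.
rewrite (@fsbig_uniqE _ _ [:: J]) ?big_seq1 ?eqxx ?mulr1 ?mulNr //.
by move=> I; rewrite inE eq_sym => /negbTE ->; rewrite !mulr0.
Qed.

End RHat.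

(** * Local operators, the Leibniz rule for wedge products, and triangular bases *)

Section LocalOperators.
Variable C : fieldType.
Implicit Types (w : nat -> vect C) (x y : vect C) (F G : vect C -> vect C).

Lemma vsumE (T K : Type) (r : seq K) (P : pred K) (u : K -> C)
    (w : K -> T -> C^o) i :
  (\sum_(c <- r | P c) u c *: w c) i = \sum_(c <- r | P c) u c * w c i :> C.
Proof. by rewrite fct_sumE. Qed.

Definition vlinear F := forall (a : C) x y, F (a *: x + y) = a *: F x + F y.

Lemma vlinear0 F : vlinear F -> F 0 = 0.
Proof.
move=> lF; have := lF 1 0 0; rewrite !scale1r addr0.
by move/(congr1 (fun z => z - F 0)); rewrite subrr addrK.
Qed.

Lemma vlinear_sum F (K : Type) (r : seq K) (P : pred K) (u : K -> C) (w : K -> vect C) :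
  vlinear F ->
  F (\sum_(c <- r | P c) u c *: w c) = \sum_(c <- r | P c) u c *: F (w c).
Proof.
move=> lF; elim: r => [|c r IH]; first by rewrite !big_nil vlinear0.
by rewrite !big_cons; case: (P c) => //; rewrite lF IH.
Qed.

Lemma vlinearB F x y : vlinear F -> F (x - y) = F x - F y.
Proof. by move=> lF; rewrite addrC -scaleN1r lF scaleN1r addrC. Qed.

(** Formal vectors may have infinitely many nonzero coefficients, so linearity alone does not tie
    [F] to its matrix; locality does, by [local_expand]. *)
Definition local (d : nat) F := vlinear F /\
  forall x i, (forall j : int, (`|i - j| <= d)%N -> x j = 0) -> F x i = 0.

Definition mx_op F : zmatrix C := fun i j => F (vunit C j) i.

Lemma local_banded d F : local d F -> banded d (mx_op F).
Proof.
move=> [_ lF] i j; apply: contraR; rewrite -ltnNge => h; apply/eqP/lF => k hk.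
by rewrite /vunit; case: eqP => // e; move: h; rewrite -e ltnNge hk.
Qed.

(** Within distance [d] of [i] the vector [x] agrees with its truncation to [r], on which [F] is
    computed by linearity. *)
Lemma local_expand d F x i (r : seq int) : local d F -> uniq r ->
  (forall j : int, (`|i - j| <= d)%N -> j \notin r -> x j = 0) ->
  F x i = \sum_(j <- r) mx_op F i j * x j :> C.
Proof.
move=> [linF locF] ur h.
have : F (x - \sum_(j <- r) (x j : C) *: vunit C j) i = 0.
  apply: locF => j hj.
  change (x j - (\sum_(j <- r) (x j : C) *: vunit C j) j = 0 :> C).
  rewrite vsumE; have [jr|jr] := boolP (j \in r).
    rewrite (bigD1_seq j) //= [X in _ - (_ + X)]big1 => [|k /negbTE kj].
      by rewrite addr0 /vunit eqxx mulr1 subrr.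
    by rewrite /vunit eq_sym kj mulr0.
  rewrite (h _ hj jr) big1_seq ?subrr // => k /andP[_ kr].
  rewrite /vunit; case: eqP => [e|_]; last by rewrite mulr0.
  by move: jr; rewrite e kr.
rewrite vlinearB // vlinear_sum // => /eqP.
change (F x i - (\sum_(j <- r) (x j : C) *: F (vunit C j)) i == 0 :> C ->
  F x i = \sum_(j <- r) mx_op F i j * x j :> C).
rewrite vsumE subr_eq0 => /eqP ->; apply: eq_bigr => j _.
exact: mulrC.
Qed.

(** [detn_row_col] turns the row formula into the Leibniz rule: [F] is applied to one factor [w b]
    at a time. *)
Lemma rhat_wedge_col d m F B w (J : maya) : local d F -> unitriangular w ->
  has_tail m J -> (m + d + `|J 0%N| <= B)%N ->
  rhat (mx_op F) (wedge w) J =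
    \sum_(k < B.+1) detn B.+1
       (col_upd k (fun a b => F (w b) (J a)) (fun a b => w b (J a)))
    - (\sum_(b < B.+1) mx_op F (- b%:Z) (- b%:Z)) * wedge w J :> C.
Proof.
move=> lF tw tJ hB; rewrite (rhat_wedge_row tw (local_banded lF) tJ hB).
congr (_ - _); rewrite detn_row_col; apply: eq_bigr => k _.
apply: eq_detn => a b aB bB; rewrite /col_upd; case: eqP => // _.
(* Indices above [B] are out of reach from [J a], and those below [- B] precede the leading index of
   [w b]. *)
symmetry; apply: (local_expand lF (win_uniq B)) => j hj; rewrite mem_win => jB.
have Ja := maya_le0 J a; have [_ -> //] := tw; lia.
Qed.

(** In the Leibniz rule every factor after the first is sent into the span of the preceding ones,
    which produces equal columns, and the zero diagonal removes the regularizing term. What remains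
    is the replacement of [w_0] by [F w_0], and a determinant is additive in its first column. *)
Lemma wedge_add_rhat d F w w' (u : nat -> nat -> C) :
  local d F -> unitriangular w -> unitriangular w' ->
  w' 0%N = w 0%N + F (w 0%N) -> (forall b, w' b.+1 = w b.+1) ->
  (forall b, F (w b.+1) = \sum_(c < b.+1) u b c *: w c) ->
  (forall i, mx_op F i i = 0) ->
  wedge w' = wedge w + rhat (mx_op F) (wedge w).
Proof.
move=> lF tw tw' w'0 w'S Fw F0; apply/funext => J.
have [m tJ] := maya_tail J; pose B := (m + d + `|J 0%N|)%N.
have mB : (m <= B.+1)%N by rewrite /B; lia.
change (wedge w' J = wedge w J + rhat (mx_op F) (wedge w) J :> C).
rewrite (rhat_wedge_col lF tw tJ (leqnn _)) -/B.
rewrite [X in _ - X * _]big1 // mul0r subr0.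
rewrite big_ord_recl /= [X in _ + (_ + X)]big1 ?addr0; last first.
  move=> k _; pose k' := bump 0 k.
  transitivity (detn B.+1 (col_upd k'
     (fun a b => \sum_(c < k.+1) u k c * w c (J a)) (fun a b => w b (J a)))).
    apply: eq_detn => a b _ _; rewrite /col_upd; case: eqP => // ->.
    by rewrite /k' /bump /= add1n Fw vsumE.
  have k'B : (k' < B.+1)%N by rewrite /k' /bump; have := ltn_ord k; lia.
  rewrite (detn_col_upd_sum _ _ (fun (c : 'I_k.+1) _ => u k c)
    (fun c a _ => w c (J a))) //.
  apply: big1 => c _; rewrite (@detn_col_eq _ _ _ k' c) ?mulr0 //.
  - by have := ltn_ord c; have := ltn_ord k; lia.
  - by rewrite /k' /bump; have := ltn_ord c; lia.
  move=> a; rewrite /col_upd eqxx ifF //.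
  by apply/eqP; rewrite /k' /bump; have := ltn_ord c; lia.
rewrite !wedgeE (wedge_atE tw tJ mB) (wedge_atE tw' tJ mB).
have E (x : vect C) :
    detn B.+1 (col_upd 0 (fun a b => x (J a)) (fun a b => w b (J a))) =
    \sum_(a < B.+1)
      x (J a) * cofactor (\matrix_(a < B.+1, b < B.+1) w b (J a)) a ord0.
  by rewrite (detn_col_upd ord0).
transitivity (detn B.+1 (col_upd 0 (fun a b => (w 0%N + F (w 0%N)) (J a))
                                   (fun a b => w b (J a)))).
  apply: eq_detn => a b _ _; rewrite /col_upd; case: b => [|b] /=; first by rewrite w'0.
  by rewrite w'S.
transitivity (detn B.+1 (col_upd 0 (fun a b => w 0%N (J a)) (fun a b => w b (J a))) +
  detn B.+1 (col_upd 0 (fun a b => F (w 0%N) (J a)) (fun a b => w b (J a)))).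
  rewrite !E -big_split; apply: eq_bigr => a _ /=.
  exact: mulrDl.
by congr (_ + _); apply: eq_detn => a b _ _; rewrite /col_upd; case: eqP => // ->.
Qed.

(** Reduced echelon form: projected to the span of [v_0, v_-1, ...], the family becomes the standard
    basis. The coefficients of a combination are then its values at the indices [- c]. *)
Definition reduced w :=
  (forall b, w b (- b%:Z) = 1) /\
  (forall b (i : int), i <= 0 -> i != - b%:Z -> w b i = 0).

Lemma reduced_tri w : reduced w -> unitriangular w.
Proof. by move=> [w1 w0]; split=> // b i ib; apply: w0; lia. Qed.

Lemma wedge_vacuum w : unitriangular w -> wedge w vacuum_maya = 1 :> C.
Proof.
move=> tw; have tV : has_tail 0 vacuum_maya by [].
by rewrite wedgeE (wedge_atE tw tV (leqnn 0)) /wdet /detn det_mx00.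
Qed.

Lemma lspanP w x :
  lspan w x <-> exists K (u : nat -> C), x = \sum_(c < K) u c *: w c.
Proof.
split=> [[s _ <-]|[K [u ->]]]; first by exists (size s), (fun c => s`_c).
exists (mkseq u K) => //; rewrite size_mkseq; apply: eq_bigr => c _.
by rewrite nth_mkseq.
Qed.

(* [F] maps [w_b] to a combination that may involve columns [w_c] outside the
   finite section; for a reduced basis these do not contribute, because row [b]
   of the section then vanishes. *)
Lemma rhat_wedge_eigen d F w : local d F -> reduced w ->
  (forall b, lspan w (F (w b))) ->
  exists kappa : C, rhat (mx_op F) (wedge w) = kappa *: wedge w.
Proof.
move=> lF rw Fw; have tw := reduced_tri rw; have [w1 w0] := rw.
have /choice[K /choice[u hu]] : forall b, exists K, exists u : nat -> C,
    F (w b) = \sum_(c < K) u c *: w c by move=> b; apply/lspanP.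
have huE b c : (c < K b)%N -> u b c = F (w b) (- c%:Z).
  move=> cK; rewrite hu vsumE (bigD1 (Ordinal cK)) //= w1 mulr1 big1 ?addr0 //.
  move=> c' /eqP h; rewrite w0 ?mulr0; [by []|by lia|apply/eqP => e].
  by apply: h; apply: val_inj => /=; lia.
have u0 b c : (c < K b)%N -> (b + d < c)%N -> u b c = 0.
  move=> cK h; rewrite huE //; have [_ loc] := lF; apply: loc => j hj.
  by have [_ -> //] := tw; lia.
(* The regularized trace: the diagonal coefficients of [F] in the basis [w] minus its diagonal
   entries at [0, -1, ..., -B]. *)
pose kap B := \sum_(b < B.+1) (F (w b) (- b%:Z) : C)
  - \sum_(b < B.+1) mx_op F (- b%:Z) (- b%:Z).
have main (J : maya) m B : has_tail m J -> (m + d + `|J 0%N| <= B)%N ->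
    rhat (mx_op F) (wedge w) J = kap B * wedge w J :> C.
  move=> tJ hB; rewrite (rhat_wedge_col lF tw tJ hB) /kap mulrBl; congr (_ - _).
  have mB : (m <= B.+1)%N by lia.
  rewrite mulr_suml; apply: eq_bigr => b _.
  rewrite wedgeE (wedge_atE tw tJ mB).
  transitivity (detn B.+1 (col_upd b
      (fun a _ => \sum_(c < K b) u b c * w c (J a)) (fun a b => w b (J a)))).
    apply: eq_detn => a b' _ _; rewrite /col_upd; case: eqP => // ->.
    by rewrite hu vsumE.
  rewrite (detn_col_upd_sum _ _ (fun (c : 'I_(K b)) _ => u b c)
    (fun c a _ => w c (J a))) //.
  have z (c : nat) : (c < K b)%N -> c <> b -> u b c * detn B.+1
      (col_upd b (fun a _ => w c (J a)) (fun a b => w b (J a))) = 0.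
    move=> cK cb; have [cB|Bc] := ltnP c B.+1.
      rewrite (@detn_col_eq _ _ _ b c) ?mulr0 //; first by move=> e; apply: cb.
      by move=> a; rewrite /col_upd eqxx ifF //; apply/eqP.
    have [bd|bd] := ltnP (b + d) c; first by rewrite u0 // mul0r.
    rewrite (@detn_row0 _ _ _ b) ?mulr0 // => b' b'B.
    rewrite /col_upd tJ; last by lia.
    by case: eqP => [_|/eqP h]; apply: w0; lia.
  have [bK|Kb] := ltnP b (K b).
    rewrite (bigD1 (Ordinal bK)) //= big1 ?addr0; last first.
      by move=> c /eqP h; apply: z => // e; apply: h; apply: val_inj.
    rewrite huE //; congr (_ * _); apply: eq_detn => a b' _ _.
    by rewrite /col_upd; case: eqP => // ->.
  rewrite big1 => [|c _]; last by apply: z => // e; have := ltn_ord c; lia.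
  rewrite hu vsumE big1 ?mul0r // => c _.
  by have cK := ltn_ord c; rewrite w0 ?mulr0 //; lia.
(* The scalar must not depend on [J], whereas [B] does. It is read off at the vacuum, where the
   wedge product is [1], using for both diagrams the [B] chosen for [J]. *)
exists (rhat (mx_op F) (wedge w) vacuum_maya); apply/funext => J.
have [m tJ] := maya_tail J; pose B := (m + d + `|J 0%N|)%N.
have tV : has_tail 0 vacuum_maya by [].
change (rhat (mx_op F) (wedge w) J =
  (rhat (mx_op F) (wedge w) vacuum_maya : C) * wedge w J :> C).
rewrite (main J m B tJ (leqnn _)) (main vacuum_maya 0%N B tV); last first.
  by rewrite /B /=; lia.
by rewrite wedge_vacuum // mulr1.
Qed.

Lemma lspan0 w : lspan w 0.
Proof. by apply/lspanP; exists 0%N, (fun=> 0); rewrite big_ord0. Qed.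

Lemma lspan_mem w b : lspan w (w b).
Proof.
apply/lspanP; exists b.+1, (fun c => (c == b)%:R).
rewrite big_ord_recr /= eqxx scale1r big1 ?add0r // => c _.
by rewrite ltn_eqF // scale0r.
Qed.

Lemma lspanZD w (a : C) x y : lspan w x -> lspan w y -> lspan w (a *: x + y).
Proof.
move=> /lspanP[K [u ->]] /lspanP[L [v ->]]; apply/lspanP.
exists (maxn K L), (fun c =>
  a * (if (c < K)%N then u c else 0) + (if (c < L)%N then v c else 0)).
under [RHS]eq_bigr do rewrite scalerDl -scalerA.
rewrite big_split /= -scaler_sumr; congr (a *: _ + _).
  rewrite (big_ord_widen (maxn K L) (fun c => u c *: w c)) ?leq_maxl //.
  by rewrite big_mkcond; apply: eq_bigr => c _; case: ifP; rewrite ?scale0r.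
rewrite (big_ord_widen (maxn K L) (fun c => v c *: w c)) ?leq_maxr //.
by rewrite big_mkcond; apply: eq_bigr => c _; case: ifP; rewrite ?scale0r.
Qed.

Lemma lspanD w x y : lspan w x -> lspan w y -> lspan w (x + y).
Proof. by move=> hx hy; rewrite -[x]scale1r; exact: lspanZD. Qed.

Lemma lspanZ w (a : C) x : lspan w x -> lspan w (a *: x).
Proof. by move=> hx; rewrite -[_ *: _]addr0; apply: lspanZD => //; exact: lspan0. Qed.

Lemma lspanB w x y : lspan w x -> lspan w y -> lspan w (x - y).
Proof. by move=> hx hy; rewrite addrC -scaleN1r; exact: lspanZD. Qed.

Lemma lspan_sum w (K : nat) (x : nat -> vect C) (u : nat -> C) :
  (forall c, (c < K)%N -> lspan w (x c)) -> lspan w (\sum_(c < K) u c *: x c).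
Proof.
move=> h; elim: K h => [|K IH] h; first by rewrite big_ord0; exact: lspan0.
rewrite big_ord_recr /= addrC; apply: lspanZD; first exact: h.
by apply: IH => c cK; apply: h; exact: ltnW.
Qed.

Lemma lspan_sub w w' x : (forall b, lspan w (w' b)) -> lspan w' x -> lspan w x.
Proof. by move=> h /lspanP[K [u ->]]; exact: lspan_sum. Qed.

(** The combination is stripped from its last term: the coefficient of [w K] is the value at [- K],
    which vanishes for [K >= b]. *)
Lemma lspan_low w x b : unitriangular w -> lspan w x ->
  (forall i : int, i <= - b%:Z -> x i = 0) ->
  exists u : nat -> C, x = \sum_(c < b) u c *: w c.
Proof.
move=> [w1 w0] /lspanP[K [u]]; elim: K x => [|K IH] x -> hx.
  by exists (fun=> 0); rewrite big_ord0 big1 // => c _; rewrite scale0r.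
have [Kb|bK] := ltnP K b.
  exists (fun c => if (c < K.+1)%N then u c else 0).
  rewrite (big_ord_widen b (fun c => u c *: w c)) //.
  by rewrite big_mkcond; apply: eq_bigr => c _; case: ifP; rewrite ?scale0r.
have uK : u K = 0.
  have <- : (\sum_(c < K.+1) u c *: w c) (- K%:Z) = 0 by apply: hx; lia.
  rewrite vsumE big_ord_recr /= w1 mulr1 big1 ?add0r // => c _.
  by rewrite w0 ?mulr0 //; have := ltn_ord c; lia.
rewrite big_ord_recr /= uK scale0r addr0 in hx *.
exact: IH.
Qed.

Lemma adapted_basisE (P : set (vect C)) w :
  adapted_basis P w <-> lspan w = P /\ unitriangular w.
Proof. by split=> [[]|[? []]]. Qed.

(** The difference [w b - w' b] has no terms at indices [<= - b], so it involves only the [w c] with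
    [c < b], which lie in the span of [w'] by induction. *)
Lemma unitriangular_span w w' : unitriangular w -> unitriangular w' ->
  (forall b, lspan w (w' b)) -> lspan w' = lspan w.
Proof.
move=> tw tw' h; have [w1 w0] := tw; have [w'1 w'0] := tw'.
apply/seteqP; split=> x; first exact: lspan_sub.
apply: lspan_sub => b; elim/ltn_ind: b => b IH.
have [||u e] := @lspan_low w (w b - w' b) b tw.
- by apply: lspanB => //; exact: lspan_mem.
- move=> i ib; change (w b i - w' b i = 0 :> C).
  have [->|ne] := eqVneq i (- b%:Z); first by rewrite w1 w'1 subrr.
  by rewrite w0 ?w'0 ?subrr //; lia.
rewrite -(subrK (w' b) (w b)) e; apply: lspanD; last exact: lspan_mem.
by apply: lspan_sum => c cb; exact: IH.
Qed.

(** The change of basis is upper unitriangular, so all finite sections keep their determinants.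
    Hence the tau-function does not depend on the adapted basis. *)
Lemma unitriangular_wedge w w' : unitriangular w -> unitriangular w' ->
  (forall b, lspan w (w' b)) -> wedge w' = wedge w.
Proof.
move=> tw tw' h; have [w1 w0] := tw; have [w'1 w'0] := tw'.
have /choice[u hu] : forall b, exists u : nat -> C,
    w' b - w b = \sum_(c < b) u c *: w c.
  move=> b; apply: lspan_low => //; first by apply: lspanB => //; exact: lspan_mem.
  move=> i ib; change (w' b i - w b i = 0 :> C).
  have [->|ne] := eqVneq i (- b%:Z); first by rewrite w1 w'1 subrr.
  by rewrite w0 ?w'0 ?subrr //; lia.
apply/funext => J; have [m tJ] := maya_tail J.
rewrite !wedgeE (wedge_atE tw tJ (leqnn m)) (wedge_atE tw' tJ (leqnn m)).
apply: (detn_unitri (u := fun c b => if (c < b)%N then u b c else (c == b)%:R)).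
- by move=> c b bc; rewrite ifF ?gtn_eqF // ltnNge ltnW.
- by move=> b; rewrite ltnn eqxx.
move=> a b bm; rewrite -(subrK (w b) (w' b)) hu.
transitivity ((\sum_(c < b) u b c *: w c) (J a) + w b (J a) : C) => //.
rewrite vsumE (bigD1 (Ordinal bm)) //= ltnn eqxx mulr1 addrC; congr (_ + _).
rewrite (big_ord_widen m (fun c => u b c * w c (J a))) 1?ltnW //.
rewrite big_mkcond [RHS]big_mkcond.
apply: eq_bigr => c _; rewrite -val_eqE /=.
by case: ltngtP => // _; rewrite ?mulr0 // mulrC.
Qed.

(** Gaussian elimination: [w b] is cleared at the indices [- c], [c < b], by means of the vectors
    already reduced. *)
Lemma reduced_exists w : unitriangular w ->
  exists w', reduced w' /\ forall b, lspan w (w' b).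
Proof.
move=> tw; have [w1 w0] := tw.
have H b : exists x, lspan w x /\ forall i : int, i <= 0 -> x i = (i == - b%:Z)%:R.
  elim/ltn_ind: b => b IH.
  have /choice[y hy] : forall c, exists x, (c < b)%N ->
      lspan w x /\ forall i : int, i <= 0 -> x i = (i == - c%:Z)%:R.
    move=> c; have [cb|_] := ltnP c b; last by exists 0.
    by have [x hx] := IH c cb; exists x.
  exists (w b - \sum_(c < b) (w b (- c%:Z) : C) *: y c); split.
    apply: lspanB; first exact: lspan_mem.
    by apply: (lspan_sum (fun c => w b (- c%:Z))) => c /hy[].
  move=> i i0; change (w b i - (\sum_(c < b) (w b (- c%:Z) : C) *: y c) i =
    (i == - b%:Z)%:R :> C).
  rewrite vsumE.
  have E (c : 'I_b) : y c i = (i == - (c : nat)%:Z)%:R.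
    by have [_ ->] := hy c (ltn_ord c).
  have [ib|bi] := ltnP `|i|%N b.
    rewrite (bigD1 (Ordinal ib)) //= big1 ?addr0 => [|c hc].
      rewrite (E (Ordinal ib)) /= (_ : - (`|i|%N)%:Z = i); last by lia.
      rewrite eqxx mulr1 subrr.
      by case: eqP => // e; exfalso; lia.
    rewrite E; case: eqP => [e|_]; last by rewrite mulr0.
    by case/eqP: hc; apply: val_inj => /=; lia.
  rewrite big1 ?subr0 => [|c _].
    have [->|ne] := eqVneq i (- b%:Z); first by rewrite w1.
    by rewrite w0 //; lia.
  rewrite E; case: eqP => [e|_]; last by rewrite mulr0.
  by have := ltn_ord c; lia.
have [w' hw'] := choice H; exists w'; split=> [|b]; last by have [] := hw' b.
split=> [b|b i i0 /negbTE ne]; have [_ ->] := hw' b => //.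
- by rewrite eqxx.
- by lia.
- by rewrite ne.
Qed.

End LocalOperators.

(** * The boson-fermion correspondence *)

(** This is the size of the partition with parts [I k + k]. *)
Definition energy (I : maya) : int := \sum_(k \in [set: nat]) (I k + k%:Z).

Lemma energyE n (I : maya) : has_tail n I -> energy I = \sum_(k < n) (I k + k%:Z).
Proof. by move=> tI; apply: fsbig_natE => k nk; rewrite tI // addNr. Qed.

Lemma energy_vacuum : energy vacuum_maya = 0.
Proof. by rewrite (@energyE 0) // big_ord0. Qed.

(** A partition of size at most [d] has at most [d] parts. *)
Lemma energy_tail (I : maya) d : energy I <= d%:Z -> has_tail d I.
Proof.
move=> hd a da; have [n tI] := maya_tail I.
have [an|na] := ltnP a n; last exact: tI.
apply/eqP; rewrite eq_le maya_ge andbT leNgt; apply/negP => h.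
move: hd; rewrite (energyE tI) leNgt => /negP; apply.
rewrite -(big_mkord xpredT (fun k : nat => I k + k%:Z)) (@big_cat_nat _ _ _ a.+1) //=.
have h1 : a.+1%:Z <= \sum_(0 <= k < a.+1) (I k + k%:Z).
  rewrite -[X in X <= _](_ : \sum_(0 <= k < a.+1) 1 = a.+1%:Z); last first.
    by rewrite big_const_nat subn0 iter_addr_0 -[LHS]mulr_natr mul1r natz.
  rewrite !big_nat; apply: ler_sum => k /andP[_ ka].
  by have := maya_shift_le I (ka : (k <= a)%N); lia.
have h2 : 0 <= \sum_(a.+1 <= k < n) (I k + k%:Z).
  by apply: sumr_ge0 => k _; have := maya_ge I k; lia.
apply: lt_le_trans (lerD h1 h2); lia.
Qed.

(** A diagram of energy [e] is determined by its first [|e|] parts, each of which is at most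
    [|e|]. *)
Lemma finite_energy (e : int) : finite_set [set I | energy I = e].
Proof.
pose d := `|e|%N.
pose h (t : {ffun 'I_d -> 'I_d.+1}) := xget vacuum_maya
  [set I : maya | has_tail d I /\
                  forall k : 'I_d, I k + (k : nat)%:Z = (t k : nat)%:Z].
apply: (@sub_finite_set _ _ (h @` [set: {ffun 'I_d -> 'I_d.+1}])); last first.
  exact: finite_image.
move=> I /= eI; have tI : has_tail d I by apply: energy_tail; rewrite eI /d; lia.
have up k : (k < d)%N -> (absz (I k + k%:Z)%R < d.+1)%N.
  move=> kd; have := energyE tI; rewrite eI (bigD1 (Ordinal kd)) //=.
  set T := \sum_(i < d | _) _ => E.
  have T0 : 0 <= T by apply: sumr_ge0 => i _; have := maya_ge I i; lia.
  have h1 := maya_ge I k; have h2 : e = I k + k%:Z + T by rewrite [LHS]E.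
  by clear E; rewrite /d; lia.
exists [ffun k : 'I_d => inord (absz (I k + (k : nat)%:Z))] => //.
apply: xget_unique.
  split=> // k; rewrite ffunE inordK; last exact: up.
  by have := maya_ge I k; lia.
move=> K [tK hK]; apply: maya_ext => k; have [kd|dk] := ltnP k d; last by rewrite tI ?tK.
have := hK (Ordinal kd); rewrite ffunE inordK /=; last exact: up.
by have := maya_ge I k; lia.
Qed.

Section BosonFermion.
Variable C : numFieldType.
Implicit Types (x y : fock C) (I J : maya).

(** A nonzero determinant makes [upd J k j] a rearrangement of [I], so the two sequences have the
    same sum of indices. *)
Lemma r_unit_energy i j I J :
  r_unit C i j I J != 0 -> energy J = energy I + i - j.
Proof.
apply: contra_neqP => ne; rewrite r_unitE fsbig1 // => k _.
have [Jk|_] := eqVneq (J k) i; last by rewrite mul0r.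
rewrite mul1r; apply/eqP/negPn/negP => h; apply: ne.
have [n [kn tI tJ]] := common_tail k.+1 I J.
have tU := has_tail_upd j tJ (leqnn n) kn.
rewrite (wedge_mvectE C tU tI (leqnn n)) in h.
have [s hs] := wdet_mvect_neq0 h.
have E : \sum_(a < n) upd J k j a = \sum_(a < n) I a.
  rewrite (reindex_inj (@perm_inj _ s^-1%g)) /=.
  by apply: eq_bigr => a _; rewrite hs permKV.
pose R := \sum_(a < n | a != Ordinal kn) J a.
have EJ : \sum_(a < n) J a = i + R by rewrite (bigD1 (Ordinal kn)) //= Jk.
have EU : \sum_(a < n) upd J k j a = j + R.
  rewrite (bigD1 (Ordinal kn)) //= {1}/upd eqxx; congr (_ + _).
  by apply: eq_bigr => a ak; rewrite /upd ifF //; apply/negbTE.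
rewrite (energyE tI) (energyE tJ) !big_split /= -E EJ EU.
by ring.
Qed.

Lemma J_energy (n : int) x J : n != 0 -> J_ n x J != 0 ->
  exists I, x I != 0 /\ energy J = energy I - n.
Proof.
move=> n0; rewrite /J_.
change (- rhat (mx_zeta C n) x J != 0 :> C ->
  exists I, x I != 0 /\ energy J = energy I - n).
rewrite oppr_eq0 => h; apply: contrapT => /forallNP ne; move/eqP: h; apply.
rewrite /rhat fsbig1 // => I _; have [->|xI] := eqVneq (x I) 0; first exact: mul0r.
rewrite /rhat_coef fsbig1 ?mulr0 // => -[i j] _ /=.
rewrite /mx_zeta; have [ij|_] := eqVneq i (j - n); last by rewrite mul0r.
rewrite mul1r /rhat_unit (_ : (i == j) = false) ?subr0; last first.
  by apply/eqP => e; move: n0; apply/negP/negPn/eqP; lia.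
apply/eqP/negPn/negP => /r_unit_energy E; apply: (ne I); split=> //.
by rewrite E ij; lia.
Qed.

Definition monom (m : {cmonom nat}) : fps C := fun k => (k == m)%:R.

Definition homogeneous (e : int) x := forall I, x I != 0 -> energy I = e.

Lemma homogeneous_fin e x : homogeneous e x -> fin_fock x.
Proof. by move=> h; apply: sub_finite_set (finite_energy e) => I; exact: h. Qed.

Lemma fin_fock0 : fin_fock (0 : fock C).
Proof. by apply: (@homogeneous_fin 0) => I; rewrite eqxx. Qed.

Lemma fin_fockZD (a : C) x y : fin_fock x -> fin_fock y -> fin_fock (a *: x + y).
Proof.
move=> fx fy; apply: (@sub_finite_set _ _ ([set I | x I != 0] `|` [set I | y I != 0])).
  move=> I /= h; apply: contrapT => /not_orP[/negP/negPn/eqP x0 /negP/negPn/eqP y0].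
  by move/eqP: h; apply; change (a * x I + y I = 0 :> C); rewrite x0 y0 mulr0 addr0.
by rewrite finite_setU.
Qed.

Lemma fin_fock_sum (K : Type) (r : seq K) (P : pred K) (c : K -> C) (f : K -> fock C) :
  (forall k, fin_fock (f k)) -> fin_fock (\sum_(k <- r | P k) c k *: f k).
Proof.
move=> h; elim: r => [|k r IH]; first by rewrite big_nil; exact: fin_fock0.
by rewrite big_cons; case: (P k) => //; exact: fin_fockZD.
Qed.

Lemma fin_fock_mono I : fin_fock (fock_mono C I).
Proof.
apply: (@sub_finite_set _ _ [set I]) => // J; rewrite /fock_mono /=.
by case: (J =P I) => // _; rewrite eqxx.
Qed.

Variable sigma : fock C -> fps C.
Hypothesis hsigma : is_boson_fermion sigma.

Lemma sigma0 : sigma 0 = 0.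
Proof.
have [lin _ _ _ _] := hsigma; have := lin 1 0 0 fin_fock0 fin_fock0.
rewrite !scale1r addr0 => /(congr1 (fun f => f - sigma 0)).
by rewrite subrr addrK.
Qed.

Lemma sigma_sum (K : Type) (r : seq K) (P : pred K) (c : K -> C) (f : K -> fock C) :
  (forall k, fin_fock (f k)) ->
  sigma (\sum_(k <- r | P k) c k *: f k) = \sum_(k <- r | P k) c k *: sigma (f k).
Proof.
move=> h; have [lin _ _ _ _] := hsigma; elim: r => [|k r IH].
  by rewrite !big_nil sigma0.
by rewrite !big_cons; case: (P k) => //; rewrite lin ?IH //; exact: fin_fock_sum.
Qed.

Lemma sigmaZ (a : C) x : fin_fock x -> sigma (a *: x) = a *: sigma x.
Proof.
move=> fx; have [lin _ _ _ _] := hsigma.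
by rewrite -[a *: x]addr0 lin ?sigma0 ?addr0 //; exact: fin_fock0.
Qed.

Lemma sigma_inj x y : fin_fock x -> fin_fock y -> sigma x = sigma y -> x = y.
Proof.
by move=> fx fy e; have [_ [_ inj _] _ _ _] := hsigma; apply: inj; rewrite ?inE.
Qed.

Lemma mul_t_monom i m : mul_t i (monom m) = monom (mulcm m (ucm i)).
Proof.
apply/funext => k; rewrite /mul_t /monom; case: posnP => ki.
  case: eqP => // e; move: ki; rewrite e mulcmE ucmE eqxx; lia.
congr ((nat_of_bool _)%:R); apply/eqP/eqP => [<-|->].
  by apply/eqP/cmP => j; rewrite mulcmE divcmE ucmE; case: eqP => [<-|]; lia.
by apply/eqP/cmP => j; rewrite divcmE mulcmE ucmE; lia.
Qed.

(* The preimage of a monomial is obtained from the vacuum by the operators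
   [J_(-n)], each of which shifts the energy. *)
Lemma monom_preimage m : exists e, exists x, homogeneous e x /\ sigma x = monom m.
Proof.
have [_ _ vac _ mulJ] := hsigma.
have [n] := ubnP (mdeg m); elim: n m => // n IH m mn.
have [m0|/eqP m0] := eqVneq (mdeg m) 0%N.
  exists 0, (vacuum C); split.
    move=> I; rewrite /vacuum /fock_mono.
    by case: (I =P _) => [->|_]; rewrite ?energy_vacuum // eqxx.
  by rewrite vac (mdeg_eq0I m0).
have [i mi] : exists i, (0 < m i)%N.
  apply: contrapT => /forallNP h; apply: m0; rewrite mdegE big1 // => i _.
  by have := h i; lia.
pose m' := divcm m (ucm i).
have em : m = mulcm m' (ucm i).
  by apply/eqP/cmP => j; rewrite mulcmE divcmE ucmE; case: eqP => [<-|]; lia.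
have [|e [x [hx sx]]] := IH m'.
  move: mn; rewrite em; have -> := @mdegM _ m' (ucm i).
  by rewrite mdegU addn1 ltnS.
have hJ : homogeneous (e + i.+1%:Z) (J_ (- i.+1%:Z) x).
  move=> J /J_energy[|I [/hx eI ->]]; first by lia.
  by rewrite eI; lia.
exists (e + i.+1%:Z), ((i.+1%:R : C)^-1 *: J_ (- i.+1%:Z) x); split.
  move=> I h; apply: hJ; apply: contra_neq h => h.
  by change ((i.+1%:R : C)^-1 * J_ (- i.+1%:Z) x I = 0); rewrite h mulr0.
rewrite sigmaZ; last exact: homogeneous_fin hJ.
rewrite mulJ; last exact: homogeneous_fin hx.
by rewrite scalerA mulVf ?pnatr_eq0 // scale1r sx mul_t_monom -em.
Qed.

(** Expanding [sigma v_I] in monomials and pulling these back writes [v_I] as a sum of homogeneous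
    vectors. The components whose energy differs from that of [I] must vanish, and so must their
    coefficients. *)
Lemma sigma_homogeneous : exists e : {cmonom nat} -> int,
  forall I m, sigma (fock_mono C I) m != 0 -> energy I = e m.
Proof.
have /choice[e /choice[y hy]] := monom_preimage.
exists e => I m0 h; have [_ [fwd _ _] _ _ _] := hsigma.
pose p := sigma (fock_mono C I).
have fp : finite_set [set m | p m != 0] by apply: fwd; exact: fin_fock_mono.
pose r := fset_set [set m | p m != 0].
have fy m : fin_fock (y m) by have [hm _] := hy m; exact: homogeneous_fin hm.
have mr m : (m \in r) = (p m != 0).
  by rewrite /r in_fset_set //; apply/idP/idP; rewrite inE.
have pE : p = \sum_(m <- r) (p m : C) *: monom m.
  apply/funext => m.
  transitivity (\sum_(k <- r) (p k : C) * monom k m); last by rewrite -vsumE.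
  have [mr'|/negbTE nr] := boolP (m \in r).
    rewrite (big_fsetD1 m) //= /monom eqxx mulr1 big1_fset ?addr0 // => k.
    by rewrite in_fsetD1 eq_sym => /andP[/negbTE -> _] _; rewrite mulr0.
  rewrite big1_fset => [|k kr _].
    by apply/eqP; move: nr; rewrite mr; case: eqP.
  by rewrite /monom; case: eqP => [e'|_]; [rewrite -e' nr in kr|rewrite mulr0].
have vE : fock_mono C I = \sum_(m <- r) (p m : C) *: y m.
  apply: sigma_inj; [exact: fin_fock_mono|exact: fin_fock_sum|].
  rewrite sigma_sum // -/p [LHS]pE; apply: eq_bigr => m _.
  by have [_ ->] := hy m.
apply: contrapT => ne.
(* The component of energy [e m0]: zero if [I] has another energy, although its image has the
   nonzero coefficient [p m0] at [m0]. *)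
pose z : fock C := \sum_(m <- r | e m == e m0) (p m : C) *: y m.
have z0 : z = 0.
  apply/funext => J; change (z J = 0 :> C); rewrite /z vsumE.
  have [eJ|nJ] := eqVneq (energy J) (e m0).
    have JI : J <> I by move=> JI; apply: ne; rewrite -JI.
    transitivity ((\sum_(m <- r) (p m : C) *: y m) J : C).
      rewrite vsumE big_mkcond; apply: eq_bigr => m _; case: eqP => // nem.
      have [hm _] := hy m; have [->|/hm eJm] := eqVneq (y m J) 0; first by rewrite mulr0.
      by case: nem; rewrite -eJm.
    by rewrite -vE /fock_mono; case: eqP.
  apply: big1 => m /eqP em; have [hm _] := hy m.
  have [->|/hm eJm] := eqVneq (y m J) 0; first by rewrite mulr0.
  by move: nJ; rewrite eJm em eqxx.
have : sigma z m0 = 0 by rewrite z0 sigma0.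
rewrite /z sigma_sum // vsumE big_mkcond (big_fsetD1 m0) /=; last by rewrite mr.
rewrite eqxx big1_fset => [|m].
  have [_ ->] := hy m0; rewrite /monom eqxx mulr1 addr0 => p0.
  by move/eqP: h; apply.
rewrite in_fsetD1 eq_sym => /andP[/negbTE mm0 _] _; case: eqP => // _.
by have [_ ->] := hy m; rewrite /monom mm0 mulr0.
Qed.

Lemma completedE e : (forall I m, sigma (fock_mono C I) m != 0 -> energy I = e m) ->
  forall x m, completed sigma x m =
   \sum_(I <- fset_set [set I | energy I = e m]) x I * sigma (fock_mono C I) m :> C.
Proof.
move=> he x m; apply: fsumE; first exact: finite_energy.
move=> I; rewrite /fsupp /= => h; apply: he; apply: contra_neq h => ->.
exact: mulr0.
Qed.

Lemma completed_linear (a : C) x y :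
  completed sigma (a *: x + y) = a *: completed sigma x + completed sigma y.
Proof.
have [e he] := sigma_homogeneous; apply/funext => m.
change (completed sigma (a *: x + y) m =
  a * completed sigma x m + completed sigma y m :> C).
rewrite !(completedE he) mulr_sumr -big_split; apply: eq_bigr => I _ /=.
by rewrite mulrA -mulrDl.
Qed.

Lemma completed0 : completed sigma 0 = 0.
Proof.
have := completed_linear 1 0 0; rewrite !scale1r addr0.
by move=> /(congr1 (fun f => f - completed sigma 0)); rewrite subrr addrK.
Qed.

Lemma completedZ (a : C) x : completed sigma (a *: x) = a *: completed sigma x.
Proof. by rewrite -[a *: x]addr0 completed_linear completed0 addr0. Qed.

Lemma completedD x y :
  completed sigma (x + y) = completed sigma x + completed sigma y.
Proof. by rewrite -[x]scale1r completed_linear !scale1r. Qed.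

(** The part of [x] of a given energy is a finite vector. Its image under [sigma] agrees with
    [completed sigma x] at the monomials of that energy and vanishes at the others, so injectivity
    on finite vectors applies. *)
Lemma completed_eq0 x : completed sigma x = 0 -> x = 0.
Proof.
have [e he] := sigma_homogeneous => x0; apply/funext => J.
pose r := fset_set [set I | energy I = energy J].
have mr I : (I \in r) = (energy I == energy J).
  rewrite /r in_fset_set; last exact: finite_energy.
  by apply/idP/eqP; rewrite inE.
pose z : fock C := \sum_(I <- r) (x I : C) *: fock_mono C I.
have z0 : z = 0.
  apply: sigma_inj; [exact/fin_fock_sum/fin_fock_mono|exact: fin_fock0|].
  rewrite sigma0 /z sigma_sum; last exact: fin_fock_mono.
  apply/funext => m.
  change ((\sum_(I <- r) (x I : C) *: sigma (fock_mono C I)) m = 0 :> C).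
  rewrite vsumE; have [em|nem] := eqVneq (e m) (energy J).
    by rewrite /r -em -(completedE he) x0.
  apply: big1_fset => I; rewrite mr => /eqP eI _.
  have [->|/he eI'] := eqVneq (sigma (fock_mono C I) m) 0; first by rewrite mulr0.
  by move: nem; rewrite -eI' eI eqxx.
have : z J = 0 by rewrite z0.
rewrite /z vsumE (big_fsetD1 J) /=; last by rewrite mr.
rewrite big1_fset => [|I]; first by rewrite /fock_mono eqxx mulr1 addr0.
rewrite in_fsetD1 eq_sym => /andP[/negbTE IJ _] _.
by rewrite /fock_mono IJ mulr0.
Qed.

Lemma completed_inj : injective (completed sigma).
Proof.
move=> x y e; apply/eqP; rewrite -subr_eq0; apply/eqP/completed_eq0.
by rewrite completedD -scaleN1r completedZ e scaleN1r subrr.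
Qed.

(** Injectivity makes ['pinv_] a genuine left inverse, so that all computations can be carried out
    in the Fock space. *)
Lemma fps_act_completed N s gamma X x :
  fps_act N s gamma sigma X (completed sigma x) =
  completed sigma (fock_act N s gamma X x).
Proof.
rewrite /fps_act; congr (completed sigma (fock_act _ _ _ _ _)).
by apply: pinvKV; rewrite ?inE // => y z _ _; exact: completed_inj.
Qed.

End BosonFermion.

(** * Differential operators and the Bessel equation *)

Section Operators.
Variables (C : numFieldType) (N : nat) (s : C).
Hypothesis N_gt0 : (0 < N)%N.
Implicit Types (x y : vect C) (f g : {poly C}).

Local Notation D := (Dact N s).
Local Notation pD := (polyDact N s).

(** The action of [z^k], as [z v_j = v_(j-N)]. *)
Definition zshift (k : int) (x : vect C) : vect C := fun i => x (i + k * N%:Z).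

Lemma zshift_linear k : vlinear (zshift k). Proof. by []. Qed.

Lemma zshift_zshift k l x : zshift k (zshift l x) = zshift (k + l) x.
Proof. by apply/funext => i; rewrite /zshift mulrDl addrA. Qed.

Lemma zshift0 x : zshift 0 x = x.
Proof. by apply/funext => i; rewrite /zshift mul0r addr0. Qed.

Lemma Dact_linear : vlinear D.
Proof.
move=> a x y; apply/funext => i.
change (a * x (i + 1) + y (i + 1) + (s - i%:~R) / N%:R * (a * x i + y i) =
  a * (x (i + 1) + (s - i%:~R) / N%:R * x i)
  + (y (i + 1) + (s - i%:~R) / N%:R * y i) :> C).
by ring.
Qed.

Lemma iter_Dact_linear l : vlinear (iter l D).
Proof. by elim: l => // l IH a x y; rewrite !iterS IH Dact_linear. Qed.

Lemma polyDactE n f x : (size f <= n)%N ->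
  pD f x = \sum_(l < n) f`_l *: iter l D x.
Proof.
move=> fn; rewrite /polyDact (big_ord_widen n (fun l => f`_l *: iter l D x)) //.
rewrite big_mkcond; apply: eq_bigr => l _; case: ltnP => // h.
by rewrite nth_default // scale0r.
Qed.

Lemma polyDact_linear f : vlinear (pD f).
Proof.
move=> a x y; rewrite /polyDact scaler_sumr -big_split; apply: eq_bigr => l _ /=.
by rewrite iter_Dact_linear scalerDr !scalerA mulrC.
Qed.

Lemma polyDactD f g x : pD (f + g) x = pD f x + pD g x.
Proof.
have m := leq_maxl (size f) (size g); have m' := leq_maxr (size f) (size g).
rewrite (polyDactE x (size_polyD f g)) (polyDactE x m) (polyDactE x m').
by rewrite -big_split; apply: eq_bigr => l _; rewrite coefD scalerDl.
Qed.

Lemma polyDactZ a f x : pD (a *: f) x = a *: pD f x.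
Proof.
rewrite (polyDactE x (size_scale_leq a f)) /polyDact scaler_sumr.
by apply: eq_bigr => l _; rewrite coefZ scalerA.
Qed.

Lemma polyDactC a x : pD a%:P x = a *: x.
Proof.
by rewrite (@polyDactE 1) ?size_polyC ?leq_b1 // big_ord1 coefC.
Qed.

Lemma polyDact1 x : pD 1 x = x.
Proof. by rewrite polyDactC scale1r. Qed.

Lemma polyDact0 x : pD 0 x = 0.
Proof. by rewrite polyDactC scale0r. Qed.

Lemma polyDactMX f x : pD (f * 'X) x = pD f (D x).
Proof.
rewrite (@polyDactE (size f).+1) ?size_polyMleq //; last first.
  by apply: leq_trans (size_polyMleq _ _) _; rewrite size_polyX addn2.
rewrite big_ord_recl coefMX /= scale0r add0r; apply: eq_bigr => l _.
by rewrite coefMX /= -iterSr.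
Qed.

Lemma polyDactX x : pD 'X x = D x.
Proof. by rewrite -['X]mul1r polyDactMX polyDact1. Qed.

Lemma polyDactM f g x : pD (f * g) x = pD f (pD g x).
Proof.
elim/poly_ind: g x => [|g c IH] x.
  by rewrite mulr0 !polyDact0 (vlinear0 (@polyDact_linear f)).
rewrite mulrDr mulrA !polyDactD !polyDactMX IH mulrC mul_polyC polyDactZ polyDactC.
by rewrite [_ + c *: x]addrC polyDact_linear addrC.
Qed.

Lemma polyDactMC f g x : pD f (pD g x) = pD g (pD f x).
Proof. by rewrite -!polyDactM mulrC. Qed.

Lemma polyDactXn b x : pD 'X^b x = iter b D x.
Proof.
elim: b => [|b IH]; first by rewrite expr0 polyDact1.
by rewrite exprS polyDactM polyDactX IH.
Qed.

Lemma shiftpX m : shiftp m 'X = 'X + (m%:~R)%:P :> {poly C}.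
Proof. by rewrite /shiftp comp_polyX. Qed.

Lemma shiftpC m (a : C) : shiftp m a%:P = a%:P.
Proof. by rewrite /shiftp comp_polyC. Qed.

Lemma Dact_zshift m x : D (zshift m x) = zshift m (pD ('X + (m%:~R)%:P) x).
Proof.
have N0 : N%:R != 0 :> C by rewrite pnatr_eq0 -lt0n.
rewrite polyDactD polyDactX polyDactC; apply/funext => i.
change (x (i + 1 + m * N%:Z) + (s - i%:~R) / N%:R * x (i + m * N%:Z) =
 (x (i + m * N%:Z + 1) + (s - (i + m * N%:Z)%:~R) / N%:R * x (i + m * N%:Z))
  + m%:~R * x (i + m * N%:Z) :> C).
rewrite (addrAC i 1) intrD intrM -pmulrn; field.
by rewrite N0.
Qed.

Lemma polyDact_zshift f m x : pD f (zshift m x) = zshift m (pD (shiftp m f) x).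
Proof.
elim/poly_ind: f x => [|f c IH] x.
  by rewrite shiftp0 !polyDact0 (vlinear0 (zshift_linear m)).
rewrite shiftpD shiftpM shiftpX shiftpC !polyDactD polyDactMX polyDactM.
by rewrite Dact_zshift IH !polyDactC.
Qed.

Lemma diffop_actw (d : {fset int}) (A : diffop C) x : (msupp A `<=` d)%fset ->
  diffop_act N s A x = \sum_(k <- d) zshift k (pD A@_k x).
Proof.
move=> h; rewrite /diffop_act; apply: big_fset_incl => // k _ /mcoeff_outdom ->.
by rewrite polyDact0.
Qed.

Lemma diffop_actD (A B : diffop C) x :
  diffop_act N s (A + B) x = diffop_act N s A x + diffop_act N s B x.
Proof.
pose d := (msupp A `|` msupp B)%fset.
have hA : (msupp A `<=` d)%fset by exact: fsubsetUl.
have hB : (msupp B `<=` d)%fset by exact: fsubsetUr.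
rewrite (diffop_actw x hA) (diffop_actw x hB) (diffop_actw x (msuppD_le A B)).
rewrite -big_split; apply: eq_bigr => k _ /=.
by rewrite mcoeffD polyDactD.
Qed.

Lemma diffop_act0 x : diffop_act N s 0 x = 0.
Proof. by rewrite /diffop_act msupp0 big_seq_fset0. Qed.

Lemma diffop_act_zD k f x : diffop_act N s (zD k f) x = zshift k (pD f x).
Proof. by rewrite (diffop_actw x msuppU_le) big_seq_fset1 /zD mcoeffUU. Qed.

Lemma diffop_actZ a (A : diffop C) x :
  diffop_act N s (a *: A) x = a *: diffop_act N s A x.
Proof.
change (diffop_act N s (dscale a A) x = a *: diffop_act N s A x).
rewrite /dscale (big_morph (fun B => diffop_act N s B x)
  (fun B B' => diffop_actD B B' x) (diffop_act0 x)).
rewrite [in RHS]/diffop_act scaler_sumr; apply: eq_bigr => k _.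
by rewrite diffop_act_zD polyDactZ.
Qed.

Lemma diffop_act_linear (A : diffop C) : vlinear (diffop_act N s A).
Proof.
move=> a x y; elim/diffop_ind: A => [|A B hA hB|k f].
- by rewrite !diffop_act0 scaler0 addr0.
- by rewrite !diffop_actD hA hB scalerDr !addrA; congr (_ + _); rewrite addrAC.
- by rewrite !diffop_act_zD polyDact_linear.
Qed.

Lemma diffop_actM (A B : diffop C) x :
  diffop_act N s (A * B) x = diffop_act N s A (diffop_act N s B x).
Proof.
elim/diffop_ind: A => [|A A' hA hA'|k f].
- by rewrite mul0r !diffop_act0.
- by rewrite mulrDl !diffop_actD hA hA'.
elim/diffop_ind: B => [|B B' hB hB'|m g].
- by rewrite mulr0 !diffop_act0 (vlinear0 (@diffop_act_linear _)).
- rewrite mulrDr !diffop_actD hB hB'.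
  have := @diffop_act_linear (zD k f) 1 (diffop_act N s B x) (diffop_act N s B' x).
  by rewrite !scale1r => ->.
rewrite (_ : zD k f * zD m g = zD (k + m) (shiftp m f * g)); last exact: dmul_zD.
by rewrite !diffop_act_zD polyDact_zshift zshift_zshift polyDactM.
Qed.

Lemma diffop_actX (A : diffop C) n x :
  diffop_act N s (A ^+ n) x = iter n (diffop_act N s A) x.
Proof.
elim: n => [|n IH] /=; last by rewrite exprS diffop_actM IH.
by rewrite expr0 (diffop_act_zD 0 1) polyDact1 zshift0.
Qed.

Lemma localD d e (F G : vect C -> vect C) :
  local d F -> local e G -> local (maxn d e) (fun x => F x + G x).
Proof.
move=> [lF F0] [lG G0]; split=> [a x y|x i h].
  by rewrite lF lG scalerDr !addrA; congr (_ + _); rewrite addrAC.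
change (F x i + G x i = 0 :> C); rewrite F0 ?G0 ?addr0 // => j hj; apply: h; lia.
Qed.

Lemma local_comp d e (F G : vect C -> vect C) :
  local d F -> local e G -> local (d + e) (F \o G).
Proof.
move=> [lF F0] [lG G0]; split=> [a x y|x i h] /=; first by rewrite lG lF.
by apply: F0 => j hj; apply: G0 => k hk; apply: h; lia.
Qed.

Lemma local_Dact : local 1 D.
Proof.
split=> [|x i h]; first exact: Dact_linear.
by rewrite /Dact !h ?mulr0 ?addr0 //; lia.
Qed.

Lemma local_polyDact f : exists d, local d (pD f).
Proof.
elim/poly_ind: f => [|f c [d hd]].
  by exists 0%N; split=> [|x i _]; [exact: polyDact_linear|rewrite polyDact0].
exists (maxn (d + 1) 0); have h := local_comp hd local_Dact.
have h' : local 0 (fun x : vect C => c *: x).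
  split=> [a x y|x i hx]; first by rewrite scalerDr !scalerA mulrC.
  by change (c * x i = 0); rewrite hx ?mulr0 //; lia.
have := localD h h'; congr (local _ _); apply/funext => x /=.
by rewrite polyDactD polyDactMX polyDactC.
Qed.

Lemma local_diffop (A : diffop C) : exists d, local d (diffop_act N s A).
Proof.
elim/diffop_ind: A => [|A B [d hd] [e he]|k f].
- exists 0%N; split=> [|x i _]; first exact: diffop_act_linear.
  by rewrite diffop_act0.
- exists (maxn d e); have := localD hd he; congr (local _ _).
  by apply/funext => x; rewrite diffop_actD.
have [d hd] := local_polyDact f.
have hz : local `|(k * N%:Z)%R| (zshift k) by split=> // x i h; apply: h; lia.
exists (`|(k * N%:Z)%R| + d)%N; have := local_comp hz hd; congr (local _ _).
by apply/funext => x; rewrite diffop_act_zD.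
Qed.

Definition low (k : int) x := forall i : int, i < k -> x i = 0.

Lemma iter_Dact_low l k x : low k x ->
  low (k - l%:Z) (iter l D x) /\ iter l D x (k - l%:Z) = x k.
Proof.
move=> h; elim: l => [|l [IH IH1]]; first by rewrite subr0.
rewrite iterS /Dact; split=> [i ik|].
  by rewrite !IH ?mulr0 ?addr0 //; lia.
rewrite (IH (k - _)) ?mulr0 ?addr0; last by lia.
by rewrite -IH1; congr (iter l D x _); lia.
Qed.

Lemma polyDact_low n f k x : size f = n.+1 -> low k x ->
  low (k - n%:Z) (pD f x) /\ pD f x (k - n%:Z) = f`_n * x k.
Proof.
move=> sf h; rewrite /polyDact sf; split=> [i ik|]; rewrite vsumE.
  rewrite big1 // => l _; have [hl _] := iter_Dact_low l h.
  by rewrite hl ?mulr0 //; have := ltn_ord l; lia.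
rewrite big_ord_recr /= big1 ?add0r => [|l _].
  by have [_ ->] := iter_Dact_low n h.
have [hl _] := iter_Dact_low l h.
by rewrite hl ?mulr0 //; have := ltn_ord l; lia.
Qed.

Lemma polyDact_monic_low n f k x : size f = n.+1 -> f \is monic -> low k x ->
  low (k - n%:Z) (pD f x) /\ pD f x (k - n%:Z) = x k.
Proof.
move=> sf mf h; have [h1 h2] := polyDact_low sf h; split=> //; rewrite h2.
by move/monicP: mf; rewrite lead_coefE sf /= => ->; rewrite mul1r.
Qed.

Lemma zshift_low k m x : low k x -> low (k - m * N%:Z) (zshift m x).
Proof. by move=> h i ik; apply: h; lia. Qed.

(* The two leading coefficients of [\prod_(c <- qs) (D - c)]. *)
Lemma polyDact_prod_low (qs : seq C) x (i : int) :
  low (i + (size qs)%:Z - 1) x ->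
  pD (\prod_(c <- qs) ('X - c%:P)) x i = x (i + (size qs)%:Z) +
   (\sum_(m < size qs) (s - i%:~R - m%:R) / N%:R - \sum_(c <- qs) c)
     * x (i + (size qs)%:Z - 1) :> C.
Proof.
elim: qs i => [|c qs IH] i h.
  by rewrite !big_nil big_ord0 polyDact1 subrr mul0r !addr0.
rewrite !big_cons polyDactM; set y := pD _ x.
rewrite polyDactD polyDactX -polyCN polyDactC.
rewrite (_ : (D y + - c *: y) i =
  y (i + 1) + (s - i%:~R) / N%:R * y i + - c * y i :> C) //.
have e1 : (size (c :: qs))%:Z = 1 + (size qs)%:Z by [].
rewrite e1 in h *.
have -> : y (i + 1) = x (i + (1 + (size qs)%:Z)) +
   (\sum_(m < size qs) (s - (i + 1)%:~R - m%:R) / N%:R - \sum_(c <- qs) c)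
     * x (i + (1 + (size qs)%:Z) - 1) :> C.
  by rewrite /y IH ?addrA // => j hj; apply: h; lia.
have -> : y i = x (i + (1 + (size qs)%:Z) - 1) :> C.
  have e2 : i + (1 + (size qs)%:Z) - 1 = i + (size qs)%:Z by lia.
  rewrite /y IH; last by move=> j hj; apply: h; lia.
  by rewrite e2 (h (_ - 1)) ?mulr0 ?addr0 //; lia.
rewrite big_ord_recl /= subr0.
under [in RHS]eq_bigr do rewrite /bump /= natrD opprD addrA.
under eq_bigr do rewrite intrD opprD addrA.
by ring.
Qed.

(** * The Bessel equation and its formal solution *)

Variable q : 'rV[C]_N.
Hypothesis sum_q : \sum_i q 0 i - (N%:R - 1) / 2 = s.

Definition bessel_op x := pD (charpol q) x - zshift 1 x.

Lemma bessel_op_linear : vlinear bessel_op.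
Proof.
move=> a x y; rewrite /bessel_op polyDact_linear zshift_linear scalerBr.
by rewrite opprD !addrA; congr (_ + _); rewrite addrAC.
Qed.

Lemma sum_natr n : \sum_(m < n) (m%:R : C) = n%:R * (n%:R - 1) / 2.
Proof.
elim: n => [|n IH]; first by rewrite big_ord0 !mul0r.
by rewrite big_ord_recr /= IH -natr1; field.
Qed.

(** The coefficients [x (t + 1)] coming from [P(D) x] and from [z x] cancel, and the relation
    between [s] and the sum of the [q_i] turns the factor of [x t] into [- t]. As this is nonzero
    for [t > 0], it governs the recursion for the Bessel series. *)
Lemma bessel_op_low (t : int) x : low t x ->
  bessel_op x (t - N%:Z + 1) = - t%:~R * x t :> C.
Proof.
move=> h; have N0 : N%:R != 0 :> C by rewrite pnatr_eq0 -lt0n.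
change (pD (charpol q) x (t - N%:Z + 1) - x (t - N%:Z + 1 + 1 * N%:Z) =
  - t%:~R * x t :> C).
pose qs := [seq q 0 i | i <- enum 'I_N].
have sq : size qs = N by rewrite size_map size_enum_ord.
have -> : charpol q = \prod_(c <- qs) ('X - c%:P) by rewrite /charpol big_map big_enum.
have e1 : t - N%:Z + 1 + (size qs)%:Z - 1 = t by rewrite sq; lia.
have e2 : t - N%:Z + 1 + (size qs)%:Z = t + 1 by rewrite sq; lia.
rewrite polyDact_prod_low e1 // e2 (_ : t - N%:Z + 1 + 1 * N%:Z = t + 1); last by lia.
rewrite addrC addKr; congr (_ * _).
rewrite sq -mulr_suml sumrB sumr_const card_ord sum_natr big_map big_enum /=.
rewrite (_ : \sum_i q 0 i = s + (N%:R - 1) / 2); last by rewrite -sum_q subrK.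
rewrite intrD intrB -pmulrn -mulr_natl; field.
by rewrite N0.
Qed.

Lemma is_bessel_seriesE Psi : is_bessel_series s q Psi <->
  [/\ low 0 Psi, Psi 0 = 1 & bessel_op Psi = 0].
Proof.
rewrite /is_bessel_series !diffop_act_zD zshift0 polyDact1 /bessel_op.
by split=> -[h1 h2 h3]; split=> //; [rewrite h3 subrr|apply/eqP; rewrite -subr_eq0 h3].
Qed.

(** The difference of two solutions starts at a positive index by normalization, and [bessel_op_low]
    then makes its leading coefficients vanish one after another. *)
Lemma bessel_series_unique x y :
  is_bessel_series s q x -> is_bessel_series s q y -> x = y.
Proof.
move=> /is_bessel_seriesE[x0 x1 xb] /is_bessel_seriesE[y0 y1 yb].
pose z : vect C := (-1 : C) *: y + x.
have zb : bessel_op z = 0 by rewrite bessel_op_linear xb yb scaler0 addr0.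
have zE i : z i = x i - y i :> C by rewrite addrC -[y i]mul1r -mulNr.
have z0 n : low n%:Z z.
  elim: n => [|n IH] i hi; first by apply: etrans (zE i) _; rewrite x0 ?y0 ?subrr.
  have [hn|<-] : i < n%:Z \/ n%:Z = i by lia.
    exact: IH.
  case: n IH hi => [|n] IH _.
    by apply: etrans (zE 0) _; rewrite x1 y1 subrr.
  have := bessel_op_low IH; rewrite zb => /esym/eqP; rewrite mulf_eq0 oppr_eq0.
  by rewrite intr_eq0 /= => /eqP.
apply/funext => i; apply/eqP; rewrite -subr_eq0; apply/eqP.
by apply: etrans (esym (zE i)) _; apply: (z0 `|i|.+1); lia.
Qed.

(* The coefficient of [v_t] is determined by the equation at [v_(t-N+1)], where
   it enters with the factor [- t]. *)
Lemma bessel_series_exists : exists Psi, is_bessel_series s q Psi.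
Proof.
pose X := fix X t : vect C := if t is t'.+1 then
    (bessel_op (X t') (t'.+1%:Z - N%:Z + 1) / t'.+1%:R : C) *: vunit C t'.+1%:Z + X t'
  else vunit C 0.
have XS t i : X t.+1 i = (bessel_op (X t) (t.+1%:Z - N%:Z + 1) / t.+1%:R : C) *
   (i == t.+1%:Z)%:R + X t i :> C by [].
have Xhigh t (i : int) : t%:Z < i -> X t i = 0.
  elim: t => [|t IH] ti; first by rewrite /= /vunit; case: eqP => // e; lia.
  apply: etrans (XS t i) _; rewrite IH; last by lia.
  by case: eqP => [|_]; [lia|rewrite mulr0 addr0].
have Xlow t : low 0 (X t).
  elim: t => [|t IH] i hi; first by rewrite /= /vunit; case: eqP => // e; lia.
  apply: etrans (XS t i) _; rewrite IH //.
  by case: eqP => [|_]; [lia|rewrite mulr0 addr0].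
have Xst t u (i : int) : i <= t%:Z -> (t <= u)%N -> X u i = X t i.
  move=> it; elim: u => [|u IH]; first by rewrite leqn0 => /eqP ->.
  rewrite leq_eqVlt => /orP[/eqP -> //|]; rewrite ltnS => tu.
  apply: etrans (XS u i) _; rewrite IH //.
  by case: eqP => [|_]; [lia|rewrite mulr0 add0r].
pose Psi : vect C := fun i => X `|i|%N i.
have PsiE t (i : int) : i <= t%:Z -> Psi i = X t i.
  move=> it; have [i0|i0] := ltP i 0; first by rewrite /Psi !Xlow.
  by symmetry; apply: Xst; lia.
have Plow : low 0 Psi by move=> i i0; exact: Xlow.
exists Psi; apply/is_bessel_seriesE; split=> //.
apply/funext => i; pose t := i + N%:Z - 1.
have -> : i = t - N%:Z + 1 by rewrite /t; lia.
(* For [t <= 0] the equation follows from the leading terms alone; for [t > 0] it holds by the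
   choice of the coefficient at [t]. *)
have [t0|t0] := leP t 0.
  apply: etrans (bessel_op_low _) _; first by move=> j hj; apply: Plow; lia.
  have [->|tn] := eqVneq t 0; first by rewrite oppr0 mul0r.
  by rewrite Plow ?mulr0 //; lia.
case: t t0 => [[//|t]|//] _.
pose z : vect C := (-1 : C) *: X t + Psi.
have zE j : z j = Psi j - X t j :> C by rewrite addrC -[X t j]mul1r -mulNr.
have zlow : low t.+1%:Z z.
  by move=> j hj; apply: etrans (zE j) _; rewrite (PsiE t) ?subrr //; lia.
have Ez := bessel_op_low zlow.
have zt : z t.+1%:Z = bessel_op (X t) (t.+1%:Z - N%:Z + 1) / t.+1%:R :> C.
  by rewrite zE (PsiE t.+1) // XS eqxx mulr1 (Xhigh t t.+1%:Z) ?addr0 ?subr0 //; lia.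
rewrite zt in Ez.
have : bessel_op z (t.+1%:Z - N%:Z + 1) = bessel_op Psi (t.+1%:Z - N%:Z + 1)
   - bessel_op (X t) (t.+1%:Z - N%:Z + 1) :> C.
  by rewrite bessel_op_linear [RHS]addrC -[X in _ = X + _]mulN1r.
rewrite Ez -pmulrn mulNr mulrCA divff ?pnatr_eq0 // mulr1 => /eqP.
by rewrite eq_sym subr_eq addNr => /eqP.
Qed.

Lemma bessel_seriesP : is_bessel_series s q (bessel_series s q).
Proof. exact: xgetPex bessel_series_exists. Qed.

End Operators.

(** * Bessel planes and the Darboux transformation *)

Section Plane.
Variables (C : numFieldType) (N : nat) (s : C).
Hypothesis N_gt0 : (0 < N)%N.

Local Notation D := (Dact N s).
Local Notation pD := (polyDact N s).
Local Notation admissible q := (\sum_i q 0 i - (N%:R - 1) / 2 = s).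

Lemma lspan_polyDact (x : vect C) f : lspan (fun k => iter k D x) (pD f x).
Proof. by exists (polyseq f). Qed.

Lemma lspan_polyDactP (x y : vect C) :
  lspan (fun k => iter k D x) y -> exists f, y = pD f x.
Proof.
move=> /lspanP[K [u ->]]; exists (\poly_(k < K) u k).
rewrite (polyDactE _ _ _ (size_poly K u)); apply: eq_bigr => k _.
by rewrite coef_poly ltn_ord.
Qed.

Lemma unitriangular_iter (x : vect C) : low 0 x -> x 0 = 1 ->
  unitriangular (fun k => iter k D x).
Proof.
move=> x0 x1; split=> [b|b i ib]; have [h h1] := iter_Dact_low s N_gt0 b x0.
  by move: h1; rewrite sub0r x1.
by apply: h; rewrite sub0r.
Qed.

Lemma size_charpol (q : 'rV[C]_N) : size (charpol q) = N.+1.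
Proof.
rewrite /charpol -(big_enum _ _ predT).
rewrite -(big_map (fun i => q 0 i) xpredT (fun c => 'X - c%:P)).
by rewrite size_prod_XsubC size_map size_enum_ord.
Qed.

Lemma charpol_monic (q : 'rV[C]_N) : charpol q \is monic.
Proof. by apply: monic_prod => i _; exact: monicXsubC. Qed.

Section OnePlane.
Variable q : 'rV[C]_N.
Hypothesis sum_q : admissible q.
Local Notation Psi := (bessel_series s q).

Lemma bessel_low : low 0 Psi.
Proof. by have /(is_bessel_seriesE s q _)[] := bessel_seriesP N_gt0 sum_q. Qed.

Lemma bessel_lead : Psi 0 = 1.
Proof. by have /(is_bessel_seriesE s q _)[] := bessel_seriesP N_gt0 sum_q. Qed.

Lemma bessel_eq : pD (charpol q) Psi = zshift N 1 Psi.
Proof.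
have /(is_bessel_seriesE s q _)[_ _ /eqP] := bessel_seriesP N_gt0 sum_q.
by rewrite subr_eq0 => /eqP.
Qed.

Lemma bessel_basis_adapted :
  adapted_basis (bessel_plane s q) (bessel_basis s q).
Proof.
apply: xgetPex; exists (fun k => iter k D Psi); apply/adapted_basisE.
by split=> //; apply: unitriangular_iter; [exact: bessel_low|exact: bessel_lead].
Qed.

(** This frees the argument from the basis picked by [xget]: any unitriangular family inside the
    plane computes the tau-function. *)
Lemma bessel_wedge w : unitriangular w ->
  (forall b, exists f, w b = pD f Psi) -> wedge (bessel_basis s q) = wedge w.
Proof.
move=> tw hw; have /adapted_basisE[e tb] := bessel_basis_adapted.
symmetry; apply: (unitriangular_wedge tb tw) => b; rewrite e.
by have [f ->] := hw b; exact: lspan_polyDact.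
Qed.

(** One step reads [z f(D) Psi = f(D - 1) z Psi = f(D - 1) P(D) Psi]. *)
Lemma zshift_plane (n : nat) f : exists g, zshift N n (pD f Psi) = pD g Psi.
Proof.
elim: n f => [|n IH] f; first by exists f; rewrite zshift0.
have [g hg] := IH (shiftp (-1) f * charpol q); exists g; rewrite -hg polyDactM bessel_eq.
rewrite polyDact_zshift // shiftp_shiftp addNr zshift_zshift.
have -> : shiftp 0 f = f by rewrite /shiftp mulr0z addr0 comp_polyXr.
by rewrite -addn1 PoszD.
Qed.

Lemma bessel_eigen (n : nat) f : exists kappa : C,
  rhat (mx_diffop N s (zD n f)) (wedge (bessel_basis s q)) =
  kappa *: wedge (bessel_basis s q).
Proof.
have [d hd] := local_diffop s N_gt0 (zD n f).
have tw := unitriangular_iter bessel_low bessel_lead.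
have [w' [rw' mw']] := reduced_exists tw.
have hw' b : exists f, w' b = pD f Psi by exact: lspan_polyDactP.
rewrite (bessel_wedge (reduced_tri rw') hw').
apply: (rhat_wedge_eigen (F := diffop_act N s (zD n f)) hd rw') => b.
rewrite (unitriangular_span tw (reduced_tri rw') mw').
have [g ->] := hw' b; rewrite diffop_act_zD -polyDactM.
by have [h ->] := zshift_plane n (f * g); exact: lspan_polyDact.
Qed.

Lemma wedge_bessel_vacuum : wedge (bessel_basis s q) vacuum_maya = 1 :> C.
Proof. by have /adapted_basisE[_ tb] := bessel_basis_adapted; exact: wedge_vacuum. Qed.

End OnePlane.

Lemma hook_decr n (k : nat) :
  (if k.+1 == 0%N then n.+1%:Z else - k.+1%:Z)
    < (if k == 0%N then n.+1%:Z else - k%:Z) :> int.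
Proof. by case: k => [|k] /=; lia. Qed.

Lemma hook_tail n : exists m, forall k, (m <= k)%N ->
  (if k == 0%N then n.+1%:Z else - k%:Z) = - k%:Z :> int.
Proof. by exists 1%N => -[|k]. Qed.

Definition hook n : maya := Maya (hook_decr n) (@hook_tail n).

(* The coefficient at v_(n+1) /\ v_-1 /\ v_-2 /\ ... sees the first vector of the
   basis only. *)
Lemma wedge_hook (w : nat -> vect C) n : unitriangular w ->
  wedge w (hook n) = w 0%N n.+1%:Z :> C.
Proof.
move=> tw; have t1 : has_tail 1 (hook n) by case.
rewrite wedgeE (wedge_atE tw t1 (leqnn 1)) /wdet /detn.
rewrite [\det _](expand_det_row _ ord0) big_ord1 /cofactor det_mx00 !mxE /=.
by rewrite expr0 !mulr1.
Qed.

(** The hook coefficients are those of the series at positive indices; the remaining ones are fixed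
    by normalization. *)
Lemma bessel_series_of_wedge (q q' : 'rV[C]_N) : admissible q -> admissible q' ->
  wedge (bessel_basis s q) = wedge (bessel_basis s q') ->
  bessel_series s q = bessel_series s q'.
Proof.
move=> hq hq' e.
have E (p : 'rV[C]_N) (hp : admissible p) n :
    wedge (bessel_basis s p) (hook n) = bessel_series s p n.+1%:Z :> C.
  have tw := unitriangular_iter (bessel_low hp) (bessel_lead hp).
  rewrite (bessel_wedge hp tw); first exact: (wedge_hook n tw).
  by move=> b; exists 'X^b; rewrite polyDactXn.
apply/funext => -[[|n]|n]; first by rewrite (bessel_lead hq) (bessel_lead hq').
  exact: etrans (esym (E q hq n)) (etrans (congr1 (@^~ (hook n)) e) (E q' hq' n)).
by rewrite (bessel_low hq) ?(bessel_low hq').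
Qed.

(** The difference of the two polynomials annihilates the common series, but a nonzero polynomial in
    [D] has a nonzero leading term on it. *)
Lemma bessel_series_inj (q q' : 'rV[C]_N) : admissible q -> admissible q' ->
  bessel_series s q = bessel_series s q' -> charpol q = charpol q'.
Proof.
move=> hq hq' e; apply/eqP; rewrite -subr_eq0; apply/negPn/negP => ne.
set f := charpol q - charpol q' in ne.
have f0 : pD f (bessel_series s q) = 0.
  rewrite /f polyDactD -scaleN1r polyDactZ (bessel_eq hq) e (bessel_eq hq').
  by rewrite scaleN1r subrr.
clearbody f.
have sf : size f = (size f).-1.+1 by symmetry; apply: prednK; rewrite size_poly_gt0.
have [_] := polyDact_low s N_gt0 sf (bessel_low hq).
rewrite f0 (bessel_lead hq) mulr1 => h; move/eqP: ne; apply; apply/eqP.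
by rewrite -lead_coef_eq0 lead_coefE -h.
Qed.

(** * The Darboux transformation from [r] to [r + e_1 - e_2] *)

Section Darboux.
Variables (r : 'rV[C]_N) (i1 i2 : 'I_N) (alpha : nat).
Hypothesis i12 : i1 != i2.
Hypothesis sum_r : admissible r.
Hypothesis r12 : r 0 i1 - r 0 i2 = alpha%:R.

Let r' := r + delta_mx 0 i1 - delta_mx 0 i2.
Let Q : {poly C} := \prod_(i | i != i2) ('X - (r 0 i)%:P).
Let A : diffop C :=
  - (alpha.+1%:R : C) *: (zD (-1) Q * zD (-1) (charpol r) ^+ alpha).
Let Psi := bessel_series s r.
Let u := zshift N (-1) (pD Q Psi).
Let Psi' := pD ('X - (r 0 i1)%:P) u.
Let Rest : {poly C} := \prod_(i | (i != i2) && (i != i1)) ('X - (r 0 i)%:P).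

Lemma sum_r' : admissible r'.
Proof.
rewrite -sum_r /r'; congr (_ - _).
under eq_bigr do rewrite !mxE.
rewrite sumrB big_split /=.
have h (j : 'I_N) : \sum_i (((0 : 'I_1) == 0) && (i == j))%:R = 1 :> C.
  by rewrite (bigD1 j) //= eqxx big1 ?addr0 // => i /negbTE ->.
by rewrite !h addrK.
Qed.

Lemma r1E : r 0 i1 = r 0 i2 + alpha%:R.
Proof. by rewrite -r12 addrC subrK. Qed.

Lemma QE : Q = ('X - (r 0 i1)%:P) * Rest.
Proof. by rewrite /Q (bigD1 i1). Qed.

Lemma charpolQ : charpol r = ('X - (r 0 i2)%:P) * Q.
Proof. by rewrite /charpol (bigD1 i2). Qed.

Lemma charpol_r' :
  charpol r' = ('X - (r 0 i1 + 1)%:P) * ('X - (r 0 i2 - 1)%:P) * Rest.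
Proof.
rewrite /charpol (bigD1 i2) //= (bigD1 i1) //= mulrA [X in X * _ = _]mulrC.
congr (('X - _%:P) * ('X - _%:P) * _).
- by rewrite !mxE !eqxx (negbTE i12) subr0.
- by rewrite !mxE !eqxx eq_sym (negbTE i12) addr0.
apply: eq_bigr => i /andP[/negbTE h2 /negbTE h1].
by rewrite !mxE h1 h2 !andbF addr0 subr0.
Qed.

(** The quadratic factors at [i1] and [i2] have the same sum of roots and differ by the constant
    [- (alpha + 1)], nonzero because [alpha >= 0]. *)
Lemma charpol_r'_neq : charpol r' != charpol r.
Proof.
rewrite charpol_r' charpolQ QE mulrA.
have R0 : Rest != 0 by apply/monic_neq0/monic_prod => i _; exact: monicXsubC.
rewrite -subr_eq0 -mulrBl mulf_eq0 (negbTE R0) orbF.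
rewrite (_ : _ - _ = (- (alpha.+1%:R : C))%:P) ?polyC_eq0 ?oppr_eq0 ?pnatr_eq0 //.
rewrite r1E -natr1 !(polyCD, polyCN, polyC1); ring.
Qed.

Lemma shiftp_XsubC (m : int) (a : C) : shiftp m ('X - a%:P) = 'X - (a - m%:~R)%:P.
Proof.
by rewrite shiftpD shiftpX -polyCN shiftpC -addrA -polyCD -polyCN opprB addrC.
Qed.

Lemma zshift_u : zshift N 1 u = pD Q Psi.
Proof. by rewrite /u zshift_zshift subrr zshift0. Qed.

Lemma u_eq : pD ('X - (r 0 i2 - 1)%:P) u = Psi.
Proof.
rewrite /u polyDact_zshift // shiftp_XsubC mulrN1z opprK subrK.
by rewrite -polyDactM -charpolQ bessel_eq // zshift_zshift addNr zshift0.
Qed.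

Lemma Psi'E : Psi' = - (alpha.+1%:R : C) *: u + Psi.
Proof.
rewrite -[in RHS]u_eq -(polyDactC N s) -polyDactD /Psi'; congr (pD _ u).
by rewrite r1E -natr1 !(polyCD, polyCN, polyC1); ring.
Qed.

Lemma size_Q : size Q = N.-1.+1.
Proof.
have := size_charpol r; rewrite charpolQ size_monicM ?monicXsubC //.
  by rewrite size_XsubC /= add1n => -[->]; rewrite prednK.
by apply/monic_neq0/monic_prod => i _; exact: monicXsubC.
Qed.

(** [Q(D)] lowers the leading index by [N - 1] and [z^-1] raises it by [N]. Thus [A] strictly raises
    leading indices and has zero diagonal. *)
Lemma Q_low k x : low k x -> low (k + 1) (zshift N (-1) (pD Q x)).
Proof.
move=> h; have mQ : Q \is monic by apply: monic_prod => i _; exact: monicXsubC.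
have [hl _] := polyDact_monic_low s N_gt0 size_Q mQ h.
by move=> i ik; apply: (zshift_low N_gt0 hl); lia.
Qed.

Lemma charpol_low k x : low k x -> low k (zshift N (-1) (pD (charpol r) x)).
Proof.
move=> h.
have [hl _] := polyDact_monic_low s N_gt0 (size_charpol r) (charpol_monic r) h.
by move=> i ik; apply: (zshift_low N_gt0 hl); lia.
Qed.

(** [P_r'(D) (D - r_1) u = (D - r_1 - 1) Q(D) (D + 1 - r_2) u = (D - r_1 - 1) Q(D) Psi = (D - r_1 -
    1) z u = z (D - r_1) u]. *)
Lemma Psi'_bessel : bessel_series s r' = Psi'.
Proof.
have ul : low 1 u by apply: (@Q_low 0); exact: bessel_low.
apply: (bessel_series_unique N_gt0 sum_r' (bessel_seriesP N_gt0 sum_r')).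
apply/is_bessel_seriesE; split.
- move=> i i0; rewrite Psi'E.
  change (- (alpha.+1%:R : C) * u i + Psi i = 0 :> C).
  have i1' : i < 1 by exact: lt_trans i0 ltr01.
  by rewrite (ul i i1') (bessel_low sum_r i0 : Psi i = 0) mulr0 addr0.
- rewrite Psi'E; change (- (alpha.+1%:R : C) * u 0 + Psi 0 = 1 :> C).
  rewrite ul // mulr0 add0r; exact: (bessel_lead sum_r).
apply/eqP; rewrite subr_eq0; apply/eqP.
rewrite /Psi' -polyDactM charpol_r'.
have -> : ('X - (r 0 i1 + 1)%:P) * ('X - (r 0 i2 - 1)%:P) * Rest * ('X - (r 0 i1)%:P) =
    ('X - (r 0 i1 + 1)%:P) * Q * ('X - (r 0 i2 - 1)%:P) by rewrite QE; ring.
rewrite polyDactM u_eq polyDactM -zshift_u polyDact_zshift; last exact: N_gt0.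
by rewrite shiftp_XsubC addrK.
Qed.

(** Each of the [alpha] factors [z^-1 P(D)] shifts the argument of [f] by one; the factor
    [z^-1 Q(D)] shifts it once more and turns [Psi] into [u]. *)
Lemma diffop_A f : diffop_act N s A (pD f Psi) =
  - (alpha.+1%:R : C) *: pD (shiftp alpha.+1 f) u.
Proof.
rewrite /A diffop_actZ diffop_actM // diffop_actX //; congr (_ *: _).
have -> : iter alpha (diffop_act N s (zD (-1) (charpol r))) (pD f Psi) =
    pD (shiftp alpha f) Psi.
  elim: alpha => [|a IH] /=; first by rewrite /shiftp mulr0z addr0 comp_polyXr.
  rewrite IH diffop_act_zD polyDactMC bessel_eq // polyDact_zshift //.
  rewrite zshift_zshift addNr zshift0 shiftp_shiftp.
  by congr (pD (shiftp _ f) _); lia.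
rewrite diffop_act_zD polyDactMC -zshift_u polyDact_zshift // zshift_zshift addNr zshift0.
by rewrite shiftp_shiftp; congr (pD (shiftp _ f) _); lia.
Qed.

Lemma A_low k x : low k x -> low (k + 1) (diffop_act N s A x).
Proof.
move=> h; rewrite /A diffop_actZ diffop_actM // diffop_actX // diffop_act_zD.
have h' : low k (iter alpha (diffop_act N s (zD (-1) (charpol r))) x).
  by elim: alpha => //= a IH; rewrite diffop_act_zD; exact: charpol_low.
by move=> i /(Q_low h') e; apply: etrans (_ : _ * 0 = 0 :> C); [congr (_ * _)|exact: mulr0].
Qed.

Lemma wedge_darboux : wedge (bessel_basis s r') =
  wedge (bessel_basis s r) + rhat (mx_diffop N s A) (wedge (bessel_basis s r)).
Proof.
pose g b : {poly C} := ('X - (r 0 i1)%:P) * 'X^b.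
pose w b := if b is b'.+1 then pD (g b') Psi else Psi.
pose w' b := if b is b'.+1 then pD (g b') Psi else Psi'.
have gl b (i : int) : (i < - b.+1%:Z -> pD (g b) Psi i = 0) /\
    pD (g b) Psi (- b.+1%:Z) = 1.
  have gm : g b \is monic by rewrite rpredM ?monicXsubC ?monicXn.
  have sg : size (g b) = b.+2.
    by rewrite size_monicM ?monicXsubC ?monic_neq0 ?monicXn // size_XsubC size_polyXn.
  have [h1 h2] := polyDact_monic_low s N_gt0 sg gm (bessel_low sum_r).
  split=> [ib|]; first by apply: h1; rewrite sub0r.
  by rewrite -(bessel_lead sum_r) -h2 sub0r.
have tw : unitriangular w.
  split=> [[|b]|[|b] i] /=; first exact: bessel_lead.
  - by have [] := gl b 0.
  - by rewrite oppr0; exact: bessel_low.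
  - by have [] := gl b i.
have tw' : unitriangular w'.
  split=> [[|b]|[|b] i] /=.
  - by rewrite -Psi'_bessel bessel_lead //; exact: sum_r'.
  - by have [] := gl b 0.
  - by rewrite oppr0 -Psi'_bessel; apply: bessel_low; exact: sum_r'.
  - by have [] := gl b i.
have E : wedge (bessel_basis s r) = wedge w.
  apply: (bessel_wedge sum_r tw) => -[|b]; first by exists 1; rewrite polyDact1.
  by exists (g b).
have E' : wedge (bessel_basis s r') = wedge w'.
  apply: (bessel_wedge sum_r' tw') => b; rewrite Psi'_bessel.
  case: b => [|b]; first by exists 1; rewrite polyDact1.
  (* From [Psi = (D + 1 - r_2) u] one gets [(D - r_1) D^b Psi = D^b (D + 1 - r_2) Psi']. *)
  exists ('X^b * ('X - (r 0 i2 - 1)%:P)).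
  rewrite /w' -[in LHS]u_eq /Psi' -!polyDactM; congr (pD _ u).
  by rewrite /g; ring.
have key X X' : X = wedge w -> X' = wedge w' ->
    wedge w' = wedge w + rhat (mx_diffop N s A) (wedge w) ->
    X' = X + rhat (mx_diffop N s A) X by move=> -> ->.
apply: (key _ _ E E'); clear key E E'.
have [d hd] := local_diffop s N_gt0 A.
have tP := unitriangular_iter (bessel_low sum_r) (bessel_lead sum_r).
have wP b : lspan (fun k => iter k D Psi) (w b).
  by case: b => [|b]; [exact: (lspan_mem _ 0)|exact: lspan_polyDact].
(* Since [r_1 = r_2 + alpha], the shift by [alpha + 1] takes [D - r_1] to [D + 1 - r_2], which sends
   [u] back to [Psi]. *)
have FE b : diffop_act N s A (w b.+1) =
    - (alpha.+1%:R : C) *: pD (('X + (alpha.+1%:R)%:P) ^+ b) Psi.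
  rewrite /w diffop_A -[in RHS]u_eq -polyDactM; congr (_ *: pD _ u).
  rewrite /g shiftpM shiftp_XsubC mulrC; congr (_ * _).
    by rewrite /shiftp comp_Xn_poly.
  by rewrite r1E -pmulrn -natr1; congr ('X - _%:P); ring.
have /choice[v hv] : forall b, exists v : nat -> C,
    diffop_act N s A (w b.+1) = \sum_(c < b.+1) v c *: w c.
  move=> b; apply: (lspan_low tw).
    rewrite (unitriangular_span tP tw wP) FE; apply: lspanZ; exact: lspan_polyDact.
  (* A polynomial of degree [b] in [D] gives no terms at indices below [- b], so only
     [w_0, ..., w_b] can occur. *)
  move=> i ib; rewrite FE.
  have sp : size (('X + (alpha.+1%:R)%:P : {poly C}) ^+ b) = b.+1.
    by rewrite -[X in _ + X%:P]opprK polyCN size_exp_XsubC.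
  have [h _] := polyDact_low s N_gt0 sp (bessel_low sum_r).
  change (- (alpha.+1%:R : C) * pD (('X + (alpha.+1%:R)%:P) ^+ b) Psi i = 0).
  by rewrite h ?mulr0 //; lia.
apply: (wedge_add_rhat hd tw tw' _ _ hv) => //.
- rewrite /= Psi'E addrC; congr (_ + _).
  rewrite -[in RHS](polyDact1 N s Psi) diffop_A; congr (_ *: _).
  by rewrite /shiftp comp_polyC polyDact1.
- move=> i; rewrite /mx_op; have := @A_low i (vunit C i).
  by apply; [move=> j ji; rewrite /vunit lt_eqF|lia].
Qed.

End Darboux.
End Plane.

(** * The module generated by the tau-function *)

Section Module.
Variables (C : numFieldType) (N : nat) (s : C).
Hypothesis N_gt0 : (0 < N)%N.
Variables (gamma : diffop C -> C) (sigma : fock C -> fps C).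
Hypothesis hgamma : is_W1oo_functional N s gamma.
Hypothesis hsigma : is_boson_fermion sigma.

Lemma rhatZ (A : zmatrix C) (a : C) x : rhat A (a *: x) = a *: rhat A x.
Proof.
apply/funext => J; apply: etrans (esym (mulr_fsumr a _ _)).
by apply: eq_fsbigr => I _; rewrite mulrA.
Qed.

Lemma fock_actZ X (a : C) x :
  fock_act N s gamma X (a *: x) = a *: fock_act N s gamma X x.
Proof. by rewrite /fock_act rhatZ scalerDr !scalerA mulrC. Qed.

Lemma bessel_module_submodule (q : 'rV[C]_N) :
  is_submodule N s gamma sigma (bessel_module s gamma sigma q).
Proof.
split=> [M [[]]|a f g hf hg M hM|X f hf M hM] //.
  by have [[_ MD _] _] := hM; exact: MD (hf M hM) (hg M hM).
by have [[_ _ MX] _] := hM; exact: MX (hf M hM).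
Qed.

Lemma bessel_module_tau (q : 'rV[C]_N) :
  bessel_module s gamma sigma q (bessel_tau s sigma q).
Proof. by move=> M [_]; apply. Qed.

Section Tau.
Variable q : 'rV[C]_N.
Hypothesis sum_q : \sum_i q 0 i - (N%:R - 1) / 2 = s.
Local Notation T := (wedge (bessel_basis s q)).

Lemma fock_act_bessel (n : nat) f : exists a : C,
  fock_act N s gamma (W (zD n f)) T = a *: T.
Proof.
have [kappa h] := bessel_eigen N_gt0 sum_q n f.
exists (kappa + (gamma (zD n f) + 0 * N%:R)).
by rewrite /fock_act h -scalerDl.
Qed.

(* [W (z^n f)] is [[W D, W (z^n f)] / n], and both entries act by scalars. *)
Lemma fock_act_bessel0 (n : nat) f : (0 < n)%N ->
  fock_act N s gamma (W (zD n f)) T = 0.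
Proof.
move=> n0; have nC : n%:R != 0 :> C by rewrite pnatr_eq0 -lt0n.
(* The factor [n^-1] compensates [[D, z^n g(D)] = n z^n g(D)]; the central term vanishes because
   [n != 0]. *)
pose g : {poly C} := n%:R^-1 *: f.
have [_ br] := hgamma.
have [a ha] := fock_act_bessel 0 'X; have [b hb] := fock_act_bessel n g.
have := br (W (zD 0 'X)) (W (zD n g)) T.
rewrite ha hb !fock_actZ ha hb !scalerA mulrC subrr.
suff -> : Wbracket (W (zD 0 'X)) (W (zD n g)) = W (zD n f) by [].
rewrite /Wbracket /W /= cocycle_zD oppr0 ifF; last by apply/eqP => -[e]; rewrite e in n0.
congr pair.
rewrite (_ : zD 0 'X * zD n g = zD (0 + n) (shiftp n 'X * g)); last exact: dmul_zD.
rewrite (_ : zD n g * zD 0 'X = zD (n + 0) (shiftp 0 g * 'X)); last exact: dmul_zD.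
rewrite add0r addr0 shiftpX (_ : shiftp 0 g = g); last first.
  by rewrite /shiftp mulr0z addr0 comp_polyXr.
rewrite mulrDl [g * _]mulrC zDD addrAC subrr add0r; congr (zD _ _).
by rewrite -pmulrn mul_polyC /g scalerA divff // scale1r.
Qed.

Lemma zDN k (f : {poly C}) : - zD k f = zD k (- f).
Proof. by apply/eqP; rewrite eq_sym -subr_eq0 opprK -zDD addNr zD0. Qed.

Lemma L_tau_pos (k : int) l : 0 < k ->
  fps_act N s gamma sigma (L C k l) (bessel_tau s sigma q) = 0.
Proof.
case: k => // n n0; rewrite /bessel_tau fps_act_completed; last exact: hsigma.
by rewrite /L zDN fock_act_bessel0 // completed0.
Qed.

Lemma L_tau_0 l : exists a : C,
  fps_act N s gamma sigma (L C 0 l) (bessel_tau s sigma q) = a *: bessel_tau s sigma q.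
Proof.
have [a ha] := fock_act_bessel 0 (- 'X^l); exists a.
rewrite /bessel_tau fps_act_completed; last exact: hsigma.
by rewrite /L zDN ha completedZ.
Qed.

Lemma bessel_tau_neq0 : bessel_tau s sigma q <> 0.
Proof.
move=> /(completed_eq0 hsigma) T0.
have := wedge_bessel_vacuum N_gt0 sum_q; rewrite T0 => /esym/eqP.
by rewrite oner_eq0.
Qed.

End Tau.

(** Both wedge products have vacuum coefficient [1], which forces [a = 1]; the wedge product then
    recovers the Bessel series, and the series its polynomial. *)
Lemma bessel_tau_independent (q q' : 'rV[C]_N) (a : C) :
  \sum_i q 0 i - (N%:R - 1) / 2 = s -> \sum_i q' 0 i - (N%:R - 1) / 2 = s ->
  bessel_tau s sigma q' = a *: bessel_tau s sigma q -> charpol q' = charpol q.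
Proof.
move=> hq hq' e.
have T : wedge (bessel_basis s q') = a *: wedge (bessel_basis s q).
  by apply: (completed_inj hsigma); rewrite completedZ.
have a1 : a = 1.
  have := congr1 (@^~ vacuum_maya) T.
  rewrite (wedge_bessel_vacuum N_gt0 hq') => /esym.
  by apply: etrans; rewrite -[LHS]mulr1 -(wedge_bessel_vacuum N_gt0 hq).
rewrite a1 scale1r in T.
apply: (bessel_series_inj N_gt0 hq' hq).
exact: (bessel_series_of_wedge N_gt0 hq' hq T).
Qed.

End Module.

Theorem theorem6 (R : realType) (N : nat) (hN : (2 <= N)%N) (s : R[i])
    (gamma : diffop R[i] -> R[i]) (hgamma : is_W1oo_functional N s gamma)
    (sigma : fock R[i] -> fps R[i]) (hsigma : is_boson_fermion sigma)
    (r : 'rV[R[i]]_N) (alpha : nat) :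
  let i1 : 'I_N := Ordinal (ltnW hN) in
  let i2 : 'I_N := Ordinal hN in
  \sum_i r 0 i - (N%:R - 1) / 2 = s ->
  r 0 i1 - r 0 i2 = alpha%:R ->
  let r' := r + delta_mx 0 i1 - delta_mx 0 i2 in
  let tau := bessel_tau s sigma in
  let M := bessel_module s gamma sigma in
  let A : diffop R[i] :=
    - (alpha.+1%:R : R[i]) *:
      (zD (-1) (\prod_(i | i != i2) ('X - (r 0 i)%:P))
       * zD (-1) (charpol r) ^+ alpha) in
  [/\ singular_vector s gamma sigma r (tau r'),
      exists c : R[i],
        tau r' = fps_act N s gamma sigma (W A) (tau r) + c *: tau r &
      is_submodule N s gamma sigma (M r') /\ M r' `<=` M r].
Proof.
move=> i1 i2 sum_r r12 r' tau M A.
have N_gt0 : (0 < N)%N := ltnW hN.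
have i12 : i1 != i2 by [].
have sum_r' : \sum_i r' 0 i - (N%:R - 1) / 2 = s := sum_r' i1 i2 sum_r.
have tauE : exists c : R[i],
    tau r' = fps_act N s gamma sigma (W A) (tau r) + c *: tau r.
  (* [W(A)] acts by [\hat r(A) + gamma(A)]: the constant cancels [gamma(A)] and supplies the summand
     [tau_r] of [wedge_darboux]. *)
  exists (1 - gamma A).
  rewrite /tau /bessel_tau (fps_act_completed hsigma).
  rewrite -(completedZ hsigma) -(completedD hsigma).
  congr (completed sigma _); rewrite /fock_act /= mul0r addr0 -addrA -scalerDl.
  rewrite (addrCA (gamma A)) subrr addr0 scale1r.
  apply: etrans (wedge_darboux N_gt0 i12 sum_r r12) _; exact: addrC.
have [M0 MD MX] : is_submodule N s gamma sigma (M r) by exact: bessel_module_submodule.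
have Mtau' : M r (tau r').
  have [c ->] := tauE; rewrite addrC; apply: MD; first exact: bessel_module_tau.
  by apply: MX; exact: bessel_module_tau.
split; [split| |split].
- exact: Mtau'.
- exact: (bessel_tau_neq0 N_gt0 hsigma sum_r').
- move=> [a e]; have := bessel_tau_independent N_gt0 hsigma sum_r sum_r' e.
  by apply/eqP; exact: (charpol_r'_neq i12 r12).
- by move=> k l k0; exact: (L_tau_pos N_gt0 hgamma hsigma sum_r' l k0).
- by move=> l; exact: (L_tau_0 N_gt0 gamma hsigma sum_r' l).
- exact: tauE.
- exact: bessel_module_submodule.
apply: smallest_sub; first exact: bessel_module_submodule.
by move=> _ ->.
Qed.
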